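(* Let $F$ be a locally compact complete valued field with nontrivial valuation. Let $A$ be a commutative unital Banach $F$-algebra with $\|a^{2}\|_{A}=\|a\|_{A}^{2}$ for all $a\in A$ and with finite basic dimension. Then: (i) if $F=\mathbb{C}$ is the field of complex numbers, then $A$ is isometrically $F$-isomorphic to a complex uniform algebra on some compact Hausdorff space $X$; (ii) if $F=\mathbb{R}$ is the field of real numbers, then $A$ is isometrically $F$-isomorphic to a real function algebra on $(X,\tau)$ for some compact Hausdorff space $X$ and some topological involution $\tau$ on $X$; (iii) if $F$ is non-Archimedean, then $A$ is isometrically $F$-isomorphic to an ${}^{L}/_{F}$ function algebra on $(X,\tau,g)$ for some Stone space $X$ (that is, a totally disconnected compact Hausdorff space), some finite extension $L$ of $F$ as a valued field, some $g\in\mathrm{Gal}(L/F)$ with $L^{g}=F$ and some $\tau:X\to X$. In particular $A$ is isometrically $F$-isomorphic to some subalgebra $\hat{A}$ of a basic function algebra on $X$, and $\hat{A}$ separates the points of $X$.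
   Context: A valuation on a field $F$ is a multiplicative norm $|\cdot|_{F}:F\to\mathbb{R}$ (nonnegative, zero only at $0$, multiplicative, satisfying the triangle inequality); $F$ with a valuation is a valued field, complete if it is complete in the induced metric. It is non-Archimedean if $|a-b|_F\le\max(|a|_F,|b|_F)$ for all $a,b$, otherwise Archimedean. The valuation is trivial if it takes only the values $0,1$. The fields $\mathbb{R}$ and $\mathbb{C}$ carry the absolute value. $L$ is an extension of $F$ as a valued field if $F$ is a subfield of $L$ and $|\cdot|_L$ extends $|\cdot|_F$. $\mathrm{Gal}(L/F)$ is the group of automorphisms of $L$ fixing $F$ pointwise; $L^{g}:=\{x\in L:g(x)=x\}$. A unital Banach $F$-algebra is an associative $F$-algebra $A$ with identity $1\neq0$, complete with respect to a norm $\|\cdot\|_A$ satisfying $\|ab\|_A\le\|a\|_A\|b\|_A$, $\|\alpha a\|_A=|\alpha|_F\|a\|_A$ for $\alpha\in F$, and $\|1\|_A=1$. ''Isometrically $F$-isomorphic'' means isomorphic as $F$-algebras by a norm-preserving map. A bounded multiplicative seminorm on $A$ is a map $|\cdot|:A\to[0,\infty)$, not constantly zero, with $|a|\le\|a\|_A$, $|ab|=|a||b|$, $|a+b|\le|a|+|b|$ and $|0|=0$ (the kernel may be larger than $\{0\}$). Finite basic dimension: a commutative unital Banach $F$-algebra $A$ has finite basic dimension if there exists a finite extension $L$ of $F$ extending $F$ as a valued field (with $L=F$ allowed) such that (1) for each proper closed prime ideal $J$ of $A$ that is the kernel of a bounded multiplicative seminorm on $A$, the field of fractions $\mathrm{Frac}(A/J)$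 is $F$-isomorphic (isomorphic by a map fixing $F$ pointwise) to a subfield of $L$; and (2) there is $g\in\mathrm{Gal}(L/F)$ with $L^{g}=F$. For a compact Hausdorff space $X$ and complete valued field $L$, $C_L(X)$ is the algebra of continuous $L$-valued functions on $X$ with pointwise operations and the sup norm $\|\cdot\|_\infty$. A set $A$ of functions separates the points of $X$ if for all $x_1\ne x_2$ in $X$ there is $f\in A$ with $f(x_1)\neq f(x_2)$. A complex uniform algebra on $X$ is a subalgebra of $C_{\mathbb{C}}(X)$ that is complete in the sup norm, contains the constants and separates the points of $X$. A topological involution on $X$ is a homeomorphism $\tau:X\to X$ with $\tau\circ\tau=\mathrm{id}$ (the identity is allowed). A real function algebra on $(X,\tau)$ is a real subalgebra of $\{f\in C_{\mathbb{C}}(X): f(\tau(x))=\overline{f(x)}\ \forall x\in X\}$ that is complete in the sup norm, contains $\mathbb{R}$ and separates the points of $X$. Basic function algebra: let $F,L$ be complete valued fields with $L$ a finite extension of $F$ as a valued field, $X$ a compact Hausdorff space, totally disconnected if $F$ is non-Archimedean, $g\in\mathrm{Gal}(L/F)$, and $\tau:X\to X$ continuous of finite order with $\mathrm{ord}(\tau)\mid\mathrm{ord}(g)$. The basic ${}^{L}/_{L^{g}}$ function algebra on $(X,\tau,g)$ is $C(X,\tau,g):=\{f\in C_L(X): f(\tau(x))=g(f(x))\ \forall x\in X\}$. An ${}^{L}/_{L^{g}}$ function algebra on $(X,\tau,g)$ is a subset of $C(X,\tau,g)$ that is an $L^{g}$-algebra under pointwise operations, is complete in $\|\cdot\|_\infty$,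 contains the constants $L^{g}$ and separates the points of $X$. *)

(* Defs.v *)
From HB Require Import structures.
From mathcomp Require Import all_boot all_order all_algebra all_field.
From mathcomp Require Import fraction ring_quotient.
From mathcomp Require Import complex.
From mathcomp Require Import all_classical all_reals all_analysis.
Import Order.TTheory GRing.Theory Num.Theory numFieldNormedType.Exports.

Set Implicit Arguments.
Unset Strict Implicit.
Unset Printing Implicit Defensive.

Local Open Scope classical_set_scope.
Local Open Scope ring_scope.

(* [absval_fun] is not itself a coercion: an [absval] is applied through the
   coercion [absval_group_norm] below. *)
Record absval (R : realType) (F : fieldType) := Absval {
  absval_fun : F -> R;
  absval_ge0 : forall x, 0 <= absval_fun x;
  absval_eq0 : forall x, absval_fun x = 0 <-> x = 0;
  absvalM : forall x y, absval_fun (x * y) = absval_fun x * absval_fun y;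
  absvalD : forall x y, absval_fun (x + y) <= absval_fun x + absval_fun y
}.

(* The data needed to turn an additive group into a metric space with
   distance N (x - y). The library's [normedZmodType] is not usable here, as
   it requires N (x *+ n) = N x *+ n. *)
Record group_norm (R : realType) (V : zmodType) := GroupNorm {
  group_norm_fun :> V -> R;
  group_norm_eq0 : forall x, group_norm_fun x = 0 <-> x = 0;
  group_normN : forall x, group_norm_fun (- x) = group_norm_fun x;
  group_normD : forall x y,
    group_norm_fun (x + y) <= group_norm_fun x + group_norm_fun y
}.

Definition metric_of (R : realType) (V : zmodType) (N : group_norm R V) : Type
  := V.

Section MetricOf.
Context (R : realType) (V : zmodType) (N : group_norm R V).

HB.instance Definition _ := GRing.Zmodule.on (metric_of N).

Let dist (x y : metric_of N) : R := N (x - y).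

Let distxx x : dist x x = 0.
Proof. by rewrite /dist subrr; apply/group_norm_eq0. Qed.

Let dist_eq0 x y : dist x y = 0 -> x = y.
Proof. by move=> /group_norm_eq0/eqP; rewrite subr_eq0 => /eqP. Qed.

Let dist_sym x y : dist x y = dist y x.
Proof. by rewrite /dist -opprB group_normN. Qed.

Let dist_triangle y x z : dist x z <= dist x y + dist y z.
Proof. by rewrite /dist -(subrKA y x (- z)) group_normD. Qed.

HB.instance Definition _ :=
  isMetric.Build R (metric_of N) distxx dist_eq0 dist_sym dist_triangle.

End MetricOf.

Lemma absval1 (R : realType) (F : fieldType) (v : absval R F) :
  absval_fun v 1 = 1.
Proof.
have /eqP := absvalM v 1 1; rewrite mulr1 -subr_eq0 -{1}[absval_fun v 1]mulr1.
rewrite -mulrBr mulf_eq0 subr_eq0 => /orP[/eqP/absval_eq0/eqP|/eqP//].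
by rewrite oner_eq0.
Qed.

Lemma absvalN1 (R : realType) (F : fieldType) (v : absval R F) :
  absval_fun v (-1) = 1.
Proof.
have /eqP := absvalM v (-1) (-1).
rewrite mulrNN mulr1 absval1 -expr2 eq_sym sqrf_eq1 => /orP[/eqP//|/eqP h].
by have := absval_ge0 v (-1); rewrite h oppr_ge0 ler10.
Qed.

Lemma absvalN (R : realType) (F : fieldType) (v : absval R F) x :
  absval_fun v (- x) = absval_fun v x.
Proof. by rewrite -mulN1r absvalM absvalN1 mul1r. Qed.

Coercion absval_group_norm (R : realType) (F : fieldType) (v : absval R F) :=
  GroupNorm (absval_eq0 v) (absvalN v) (absvalD v).

Section RealComplexAbsval.
Variable R : realType.

Let real_eq0 (x : R) : `|x| = 0 <-> x = 0.
Proof. by split=> [/normr0_eq0//|->]; rewrite normr0. Qed.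

Definition real_absval : absval R R :=
  Absval (@normr_ge0 _ R) real_eq0 (@normrM R) (@ler_normD _ R).

Let complex_ge0 (x : R[i]) : 0 <= ComplexField.Normc.normc x.
Proof. by case: x => a b; exact: sqrtr_ge0. Qed.

Let complex_eq0 (x : R[i]) : ComplexField.Normc.normc x = 0 <-> x = 0.
Proof.
split=> [/ComplexField.Normc.eq0_normc//|->].
exact: ComplexField.Normc.normc0.
Qed.

Definition complex_absval : absval R R[i] :=
  Absval complex_ge0 complex_eq0 (@ComplexField.Normc.normcM R)
    (@le_normcD R).

End RealComplexAbsval.

Definition nontrivial_absval (R : realType) (F : fieldType) (v : absval R F) :=
  ~ (forall x, v x = 0 \/ v x = 1).

Definition nonarchimedean (R : realType) (F : fieldType) (v : absval R F) :=
  forall x y, v (x - y) <= Num.max (v x) (v y).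

(* Stated for a raw function N, so that it also applies to the sup norm,
   which is a norm only on bounded functions. *)
Definition metric_complete (R : realType) (V : zmodType) (N : V -> R)
    (B : set V) :=
  forall u : nat -> V, (forall n, B (u n)) ->
    (forall e, 0 < e -> exists n0 : nat, forall m n : nat,
       (n0 <= m)%N -> (n0 <= n)%N -> N (u m - u n) < e) ->
    exists2 l, B l & N (u n - l) @[n --> \oo] --> (0 : R).

Definition valued_field_iso (R : realType) (F K : fieldType)
    (v : absval R F) (w : absval R K) (e : {rmorphism F -> K}) :=
  bijective e /\ forall c, w (e c) = v c.

Definition valued_extension (R : realType) (F : fieldType) (v : absval R F)
    (L : fieldExtType F) (w : absval R L) :=
  forall c : F, w c%:A = v c.

Record banach_norm (R : realType) (F : fieldType) (v : absval R F)
    (A : comAlgType F) := BanachNorm {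
  banach_norm_fun : A -> R;
  banach_norm_ge0 : forall a, 0 <= banach_norm_fun a;
  banach_norm_eq0 : forall a, banach_norm_fun a = 0 <-> a = 0;
  banach_normD : forall a b,
    banach_norm_fun (a + b) <= banach_norm_fun a + banach_norm_fun b;
  banach_normZ : forall (c : F) a,
    banach_norm_fun (c *: a) = v c * banach_norm_fun a;
  banach_normM : forall a b,
    banach_norm_fun (a * b) <= banach_norm_fun a * banach_norm_fun b;
  banach_norm1 : banach_norm_fun 1 = 1;
  banach_norm_complete : metric_complete banach_norm_fun setT
}.

Lemma banach_normN (R : realType) (F : fieldType) (v : absval R F)
    (A : comAlgType F) (nA : banach_norm v A) a :
  banach_norm_fun nA (- a) = banach_norm_fun nA a.
Proof. by rewrite -scaleN1r banach_normZ /= absvalN1 mul1r. Qed.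

Coercion banach_group_norm (R : realType) (F : fieldType) (v : absval R F)
    (A : comAlgType F) (nA : banach_norm v A) :=
  GroupNorm (banach_norm_eq0 nA) (banach_normN nA) (banach_normD nA).

Record bounded_mul_seminorm (R : realType) (F : fieldType) (v : absval R F)
    (A : comAlgType F) (nA : banach_norm v A) (s : A -> R) : Prop :=
  BoundedMulSeminorm {
  seminorm_ge0 : forall a, 0 <= s a;
  seminorm_nonzero : exists a, s a <> 0;
  seminorm_le : forall a, s a <= nA a;
  seminormM : forall a b, s (a * b) = s a * s b;
  seminormD : forall a b, s (a + b) <= s a + s b;
  seminorm0 : s 0 = 0
}.

(* The library proves that the quotient by a prime ideal has no zero divisors
   but gives it no inverse operation, so it is not an [idomainType] there; the
   unit predicate and the inverse are chosen classically here. *)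
Definition prime_quot (A : comNzRingType) (J : prime_idealr A) : Type :=
  {ideal_quot J}.

Section PrimeQuot.
Context (A : comNzRingType) (J : prime_idealr A).

HB.instance Definition _ := GRing.ComNzRing.on (prime_quot J).
HB.instance Definition _ := Quotient.on (prime_quot J).

Let unitq (x : prime_quot J) : bool := `[< exists y, y * x = 1 >].
Let invq (x : prime_quot J) : prime_quot J := xget x [set y | y * x = 1].

Let mulVq : {in unitq, left_inverse 1 invq *%R}.
Proof.
by move=> x /asboolP [y yx]; rewrite /invq; case: xgetP => [z _ //|/(_ y)].
Qed.

Let unitqP (x y : prime_quot J) : y * x = 1 -> x \in unitq.
Proof. by move=> yx; apply/asboolP; exists y. Qed.

Let invq_out : {in [predC unitq], invq =1 id}.
Proof.
move=> x /asboolPn xN; rewrite /invq; case: xgetP => // y _ /= yx.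
by case: xN; exists y.
Qed.

HB.instance Definition _ := GRing.ComNzRing_hasMulInverse.Build
  (prime_quot J) mulVq unitqP invq_out.

HB.instance Definition _ := GRing.ComUnitRing_isIntegral.Build
  (prime_quot J) (@Quotient.rquot_IdomainAxiom A J).

End PrimeQuot.

Definition frac_embeds (F : fieldType) (A : comAlgType F)
    (J : prime_idealr A) (L : fieldExtType F) :=
  exists (K : {subfield L})
         (h : {rmorphism {fraction (prime_quot J)} -> L}),
    [/\ injective h,
        (forall y : L, y \in K <-> exists x, h x = y) &
        forall c : F,
          h (FracField.tofrac (\pi_(prime_quot J)%qT c%:A)) = c%:A].

(* [kAut 1 fullv g]: g is an F-algebra automorphism of L. The group 'Gal(L / F)
   of the library needs a [splittingFieldType], which L is not assumed to be. *)
Definition Galois_aut (F : fieldType) (L : fieldExtType F) (g : 'End(L)) : Prop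
  := kAut 1%VS fullv g.

(* F sits in L and in A through c |-> c%:A. A [prime_idealr] does not contain 1,
   so J ranges over proper prime ideals; [fixedSpace g = 1%VS] says L^g = F. *)
Definition finite_basic_dimension (R : realType) (F : fieldType)
    (v : absval R F) (A : comAlgType F) (nA : banach_norm v A) :=
  exists (L : fieldExtType F) (w : absval R L),
    [/\ valued_extension v w,
        (forall J : prime_idealr A,
           closed ([set a | a \in J] : set (metric_of nA)) ->
           (exists2 s, bounded_mul_seminorm nA s &
              forall a, a \in J <-> s a = 0) ->
           frac_embeds J L) &
        exists2 g : 'End(L), Galois_aut g & fixedSpace g = 1%VS].

Section FunctionAlgebras.
Context (R : realType) (X : topologicalType) (L : fieldType)
  (w : absval R L).
Implicit Types (S : set L) (B C : set (X -> L)).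

Definition continuous_functions : set (X -> L) :=
  [set f | continuous (f : X -> metric_of w)].

Definition sup_norm (f : X -> L) : R := sup [set w (f x) | x in [set: X]].

Definition separates_points B :=
  forall x y, x <> y -> exists2 f, B f & f x <> f y.

Record function_subalgebra S B : Prop := FunctionSubalgebra {
  fsubalg0 : B (fun=> 0);
  fsubalgD : forall f h, B f -> B h -> B (fun x => f x + h x);
  fsubalgM : forall f h, B f -> B h -> B (fun x => f x * h x);
  fsubalgZ : forall c f, S c -> B f -> B (fun x => c * f x)
}.

(* A sup-norm complete subset of C that is an algebra over the scalars S,
   contains the constants S and separates the points of X. *)
Record function_algebra_in C S B : Prop := FunctionAlgebraIn {
  falg_sub : B `<=` C;
  falg_subalg : function_subalgebra S B;
  falg_complete : metric_complete sup_norm B;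
  falg_const : forall c, S c -> B (fun=> c);
  falg_separates : separates_points B
}.

(* The scalar field F of the algebra acts on L-valued functions through
   iota. *)
Record isometric_isomorphism (F : fieldType) (v : absval R F)
    (A : comAlgType F) (nA : banach_norm v A) (iota : F -> L) B
    (phi : A -> X -> L) : Prop := IsometricIsomorphism {
  isom_bij : set_bij setT B phi;
  isomD : forall a b x, phi (a + b) x = phi a x + phi b x;
  isomM : forall a b x, phi (a * b) x = phi a x * phi b x;
  isom1 : forall x, phi 1 x = 1;
  isomZ : forall c a x, phi (c *: a) x = iota c * phi a x;
  isom_norm : forall a, sup_norm (phi a) = nA a
}.

Definition isometrically_isomorphic (F : fieldType) (v : absval R F)
    (A : comAlgType F) (nA : banach_norm v A) (iota : F -> L) B :=
  exists phi, isometric_isomorphism nA iota B phi.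

End FunctionAlgebras.

Definition complex_uniform_algebra (R : realType) (X : topologicalType)
    (B : set (X -> R[i])) :=
  function_algebra_in (complex_absval R)
    (continuous_functions (complex_absval R)) setT B.

(* A continuous involution is its own inverse, hence a homeomorphism. *)
Definition topological_involution (X : topologicalType) (tau : X -> X) :=
  continuous tau /\ involutive tau.

Definition real_function_algebra (R : realType) (X : topologicalType)
    (tau : X -> X) (B : set (X -> R[i])) :=
  function_algebra_in (complex_absval R)
    [set f | continuous_functions (complex_absval R) f /\
             forall x, f (tau x) = conjc (f x)]
    (range (real_complex R)) B.

Definition is_order (T : Type) (f : T -> T) (n : nat) :=
  [/\ (0 < n)%N, iter n f =1 id &
      forall m : nat, (0 < m)%N -> iter m f =1 id -> (n <= m)%N].

Record basic_setting (R : realType) (F : fieldType) (v : absval R F)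
    (L : fieldExtType F) (w : absval R L) (X : topologicalType)
    (tau : X -> X) (g : 'End(L)) : Prop := BasicSetting {
  basic_complete_base : metric_complete v setT;
  basic_complete : metric_complete w setT;
  basic_ext : valued_extension v w;
  basic_compact : compact [set: X];
  basic_hausdorff : hausdorff_space X;
  basic_disconnected : nonarchimedean v -> totally_disconnected [set: X];
  basic_galois : Galois_aut g;
  basic_continuous : continuous tau;
  basic_order : exists m n, [/\ is_order tau m, is_order g n & (m %| n)%N]
}.

Definition basic_function_algebra (R : realType) (F : fieldType)
    (L : fieldExtType F) (w : absval R L) (X : topologicalType)
    (tau : X -> X) (g : 'End(L)) : set (X -> L) :=
  [set f | continuous_functions w f /\ forall x, f (tau x) = g (f x)].

Definition fixed_field (F : fieldType) (L : fieldExtType F) (g : 'End(L)) :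
  set L := [set c | c \in fixedSpace g].

Definition ext_function_algebra (R : realType) (F : fieldType)
    (L : fieldExtType F) (w : absval R L) (X : topologicalType)
    (tau : X -> X) (g : 'End(L)) (B : set (X -> L)) :=
  function_algebra_in w (basic_function_algebra w tau g) (fixed_field g) B.

(* Main.v *)
Require Import Defs.
From HB Require Import structures.
From mathcomp Require Import all_boot all_order all_algebra all_field.
From mathcomp Require Import fraction ring_quotient.
From mathcomp Require Import complex.
From mathcomp Require Import all_classical all_reals all_analysis.
From mathcomp Require Import ring lra.
Import Order.TTheory GRing.Theory Num.Theory numFieldNormedType.Exports.
Local Open Scope classical_set_scope.
Local Open Scope ring_scope.

(** The space X consists of the characters of A bounded by the norm, that is,
    the morphisms phi : A -> L of F-algebras with w (phi a) <= nA a, where L is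
    the finite extension given by the finite basic dimension; X carries the
    topology of pointwise convergence. Each a acts on X by evaluation, and this
    Gelfand transform is the required isomorphism onto its image. As w is
    invariant under the Galois automorphism g, composition with g maps X to X;
    this is tau, and the transform of a satisfies a (tau x) = g (a x).

    The main point is that the transform is isometric: for every a <> 0 some
    character attains the norm at a. Among the power-multiplicative seminorms
    bounded by the norm and equal to it at a, take a minimal one. The smoothing
    x |-> inf_n p (x * b ^ n) / p b ^ n produces seminorms of the same kind
    below p, so minimality forces p to be multiplicative
    ([exists_multiplicative_seminorm]). By finite basic dimension, the quotient
    of A by the kernel of p embeds in L, which yields a character phi with the
    same kernel. An absolute value has only one extension to a finite extension
    of a complete field, by equivalence of norms ([bounded_coordinates]) applied
    to all powers of an element; hence p is the absolute value of phi
    ([norm_attained_char]).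

    X is compact ([char_space_compact]): bounded ultrafilters converge in a
    locally compact nontrivially valued field, hence in L by coordinates, and
    pointwise limits of characters are characters. If F is non-Archimedean, the
    F-coordinates of the values separate the points of X, and balls of F are
    clopen, so X is totally disconnected ([char_space_zero_dimensional]).

    For F = C the field L is C itself; for F = R it is R or C, and g is the
    complex conjugation as soon as L is not R ([real_embedding]). Composing the
    Gelfand transform with an embedding of L in C gives the first two cases; the
    general facts are stated once for an arbitrary isometric embedding of L
    ([realized_function_algebra]). *)

Set Implicit Arguments.
Unset Strict Implicit.
Unset Printing Implicit Defensive.

(** * Multiplicative seminorms attaining a power-multiplicative norm *)

Section RealLemmas.
Context {R : realType}.

Lemma inf_lb (S : set R) (m : R) x :
  (forall y, S y -> m <= y) -> S x -> inf S <= x.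
Proof. by move=> mS; apply: ge_inf; exists m => y /mS. Qed.

Lemma ge_cvg {T : Type} (G : set_system T) {FG : ProperFilter G} (u : T -> R)
    (l c : R) :
  u t @[t --> G] --> l -> (forall t, c <= u t) -> c <= l.
Proof.
move=> ul cu; rewrite -(cvg_lim (@Rhausdorff R) ul); apply: limr_ge.
  by apply/cvg_ex; exists l.
by apply: nearW.
Qed.

End RealLemmas.

Section SquareSeminorms.
Context {R : realType} {A : comNzRingType}.
Implicit Types (N p q : A -> R) (a b x y : A).

(** This class is stable under infima of chains and under the smoothing below,
    which lets Zorn's lemma and smoothing work together; the condition on
    squares forces the same identity for all powers. *)
Record square_seminorm N p : Prop := SquareSeminorm {
  sqn_ge0 : forall x, 0 <= p x;
  sqn_le : forall x, p x <= N x;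
  sqnD : forall x y, p (x + y) <= p x + p y;
  sqnM : forall x y, p (x * y) <= p x * p y;
  sqn_sqr : forall x, p (x * x) = p x * p x
}.

Lemma sqn1_le1 N p : square_seminorm N p -> p 1 <= 1.
Proof.
move=> Sp; have /eqP := sqn_sqr Sp 1; rewrite mulr1 -subr_eq0.
rewrite -{1}[p 1]mulr1 -mulrBr mulf_eq0 subr_eq0.
by case/orP => [/eqP->|/eqP<-].
Qed.

Lemma sqnX_le N p b n : square_seminorm N p -> p (b ^+ n) <= p b ^+ n.
Proof.
move=> Sp; elim: n => [|n IH]; first by rewrite !expr0; exact: sqn1_le1 Sp.
rewrite !exprS (le_trans (sqnM Sp _ _))// ler_wpM2l//; exact: (sqn_ge0 Sp).
Qed.

(** Iterated squaring gives the powers of two; the power n is compared with a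
    power of two above it by submultiplicativity. *)
Lemma sqnX N p b n : square_seminorm N p -> p b != 0 -> p (b ^+ n) = p b ^+ n.
Proof.
move=> Sp pb; apply/le_anti; rewrite (sqnX_le b n Sp)/=.
have pb0 : 0 < p b by rewrite lt_def pb (sqn_ge0 Sp).
have E k : p (b ^+ (2 ^ k)) = p b ^+ (2 ^ k).
  elim: k => [|k IH]; first by rewrite !expr1.
  by rewrite expnS mul2n -addnn !exprD (sqn_sqr Sp) IH.
have nk : (n <= 2 ^ n)%N by apply: ltnW; exact: ltn_expl.
have := E n; rewrite -(subnK nk) !exprD => En.
rewrite -(ler_pM2l (exprn_gt0 (2 ^ n - n) pb0)) -En.
rewrite (le_trans (sqnM Sp _ _))// ler_wpM2r ?(sqn_ge0 Sp)//.
exact: sqnX_le Sp.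
Qed.

Definition rescaled p b x (n : nat) : R := p (x * b ^+ n) / p b ^+ n.
(** The limit of the nonincreasing sequence [rescaled p b x]. *)
Definition smoothing p b x : R := inf (range (rescaled p b x)).

Section Smoothing.
Context (N p : A -> R) (b : A) (Sp : square_seminorm N p) (pb : p b != 0).

Let pb0 : 0 < p b. Proof. by rewrite lt_def pb (sqn_ge0 Sp). Qed.

Lemma rescaled_ge0 x n : 0 <= rescaled p b x n.
Proof. by rewrite divr_ge0 ?exprn_ge0 ?(sqn_ge0 Sp). Qed.

Lemma rescaled_nonincreasing x : nonincreasing_seq (rescaled p b x).
Proof.
apply/nonincreasing_seqP => n; rewrite /rescaled exprSr mulrA.
rewrite ler_pdivrMr ?exprn_gt0// exprSr mulrA divfK ?expf_neq0//.
exact: (sqnM Sp).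
Qed.

Lemma smoothing_le_rescaled x n : smoothing p b x <= rescaled p b x n.
Proof.
by apply: (@inf_lb _ _ 0) => [_ [k _ <-]|]; [exact: rescaled_ge0|exists n].
Qed.

Lemma le_smoothing c x :
  (forall n, c <= rescaled p b x n) -> c <= smoothing p b x.
Proof.
move=> cx; apply: lb_le_inf => [|_ [k _ <-]//].
by exists (rescaled p b x 0); exists 0%N.
Qed.

Lemma rescaled_cvg x : rescaled p b x n @[n --> \oo] --> smoothing p b x.
Proof.
apply: nonincreasing_cvgn; first exact: rescaled_nonincreasing.
by exists 0 => _ [k _ <-]; exact: rescaled_ge0.
Qed.

Lemma smoothing_square_seminorm : square_seminorm N (smoothing p b).
Proof.
have sM x y : smoothing p b (x * y) <= smoothing p b x * smoothing p b y.
  (* compare with the subsequence of even index: b ^ (n + n) = b ^ n * b ^ n *)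
  apply: (ge_cvg (G := \oo)
    (u := fun n => rescaled p b x n * rescaled p b y n)).
    by apply: cvgM; exact: rescaled_cvg.
  move=> n; apply: (le_trans (smoothing_le_rescaled _ (n + n))).
  rewrite /rescaled !exprD mulrACA invfM [leRHS]mulrACA ler_wpM2r//.
    by rewrite mulr_ge0 ?invr_ge0 ?exprn_ge0 ?(sqn_ge0 Sp).
  exact: (sqnM Sp).
have s0 x : 0 <= smoothing p b x.
  by apply: le_smoothing => n; exact: rescaled_ge0.
split=> //.
- move=> x; apply: le_trans (smoothing_le_rescaled x 0) _.
  by rewrite /rescaled !expr0 mulr1 divr1 (sqn_le Sp).
- move=> x y.
  apply: (ge_cvg (G := \oo)
    (u := fun n => rescaled p b x n + rescaled p b y n)).
    by apply: cvgD; exact: rescaled_cvg.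
  move=> n; apply: (le_trans (smoothing_le_rescaled _ n)).
  rewrite /rescaled -[leRHS]mulrDl (mulrDl x y).
  by rewrite ler_wpM2r ?invr_ge0 ?exprn_ge0 ?(sqn_ge0 Sp)// (sqnD Sp).
- move=> x; apply/le_anti; rewrite sM/=; apply: le_smoothing => n.
  apply: le_trans (rescaled_nonincreasing (x * x) (leq_addr n n)).
  rewrite /rescaled !exprD mulrACA (sqn_sqr Sp) invfM mulrACA.
  by rewrite ler_pM ?s0// smoothing_le_rescaled.
Qed.

Lemma smoothing_le x : smoothing p b x <= p x.
Proof.
apply: le_trans (smoothing_le_rescaled x 0) _.
by rewrite /rescaled !expr0 mulr1 divr1.
Qed.

Lemma smoothing_ge x : smoothing p b x * p b <= smoothing p b (x * b).
Proof.
apply: le_smoothing => n.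
have -> : rescaled p b (x * b) n = rescaled p b x n.+1 * p b.
  rewrite /rescaled -(mulrA x) -exprS (exprSr (p b)) invfM.
  by rewrite [in RHS]mulrA divfK.
by rewrite ler_wpM2r ?(sqn_ge0 Sp)// smoothing_le_rescaled.
Qed.

Lemma smoothing_fix x : (forall n, p (x * b ^+ n) = p x * p b ^+ n) ->
  smoothing p b x = p x.
Proof.
move=> px; apply/le_anti; rewrite smoothing_le/=; apply: le_smoothing => n.
by rewrite /rescaled px mulfK// expf_neq0.
Qed.

End Smoothing.

(** A totally ordered family can be tested on a common smaller member, so every
    inequality between finitely many values survives the infimum. *)
Lemma chain_inf_square_seminorm N (C : set (A -> R)) : C !=set0 ->
  (forall p, C p -> square_seminorm N p) ->
  (forall p q, C p -> C q ->
    (forall x, p x <= q x) \/ (forall x, q x <= p x)) ->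
  square_seminorm N (fun x => inf [set p x | p in C]).
Proof.
move=> [p0 Cp0] CN Ctot; pose S x := [set p x | p in C].
have S0 x (z : R) : S x z -> 0 <= z.
  by move=> [p Cp <-]; exact: (sqn_ge0 (CN p Cp)).
have m_le p x : C p -> inf (S x) <= p x.
  by move=> Cp; apply: inf_lb (S0 x) _; exists p.
have m_ge c x : (forall p, C p -> c <= p x) -> c <= inf (S x).
  move=> cx; apply: lb_le_inf => [|_ [p Cp <-]]; last exact: cx.
  by exists (p0 x); exists p0.
have two p q : C p -> C q -> exists s, [/\ C s,
    forall x, s x <= p x & forall x, s x <= q x].
  move=> Cp Cq; have [h|h] := Ctot p q Cp Cq; first by exists p.
  by exists q.
have m0 x : 0 <= inf (S x).
  by apply: m_ge => p Cp; exact: (sqn_ge0 (CN p Cp)).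
have adh x e : 0 < e -> exists2 p, C p & p x < inf (S x) + e.
  move=> e0; have : has_inf (S x).
    by split; [exists (p0 x); exists p0|exists 0 => y /S0].
  by move=> /(inf_adherent e0)[_ [p Cp <-] h]; exists p.
have mM x y : inf (S (x * y)) <= inf (S x) * inf (S y).
  have H p q : C p -> C q -> inf (S (x * y)) <= p x * q y.
    move=> Cp Cq; have [s [Cs sp sq]] := two _ _ Cp Cq; have Ss := CN s Cs.
    apply: le_trans (m_le _ _ Cs) _; apply: le_trans (sqnM Ss _ _) _.
    by rewrite ler_pM ?(sqn_ge0 Ss).
  have H1 q : C q -> inf (S (x * y)) <= inf (S x) * q y.
    move=> Cq; have [q0|q0] := eqVneq (q y) 0.
      by rewrite q0 mulr0; have := H _ _ Cp0 Cq; rewrite q0 mulr0.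
    have q1 : 0 < q y by rewrite lt_def q0 (sqn_ge0 (CN q Cq)).
    by rewrite -ler_pdivrMr//; apply: m_ge => p Cp; rewrite ler_pdivrMr// H.
  have [x0|x0] := eqVneq (inf (S x)) 0.
    by have := H1 _ Cp0; rewrite x0 !mul0r.
  have x1 : 0 < inf (S x) by rewrite lt_def x0 m0.
  rewrite [leRHS]mulrC -ler_pdivrMr//; apply: m_ge => p Cp.
  by rewrite ler_pdivrMr// [leRHS]mulrC H1.
split=> //.
- by move=> x; apply: le_trans (m_le _ _ Cp0) (sqn_le (CN _ Cp0) x).
- move=> x y; apply/ler_addgt0Pr => e e0.
  have e20 : 0 < e / 2 by rewrite divr_gt0.
  have [p Cp px] := adh x _ e20; have [q Cq qy] := adh y _ e20.
  have [s [Cs sp sq]] := two _ _ Cp Cq.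
  apply: le_trans (m_le _ _ Cs) _; apply: le_trans (sqnD (CN _ Cs) _ _) _.
  rewrite [e]splitr addrACA lerD//; first exact: le_trans (sp x) (ltW px).
  exact: le_trans (sq y) (ltW qy).
- move=> x; apply/le_anti; rewrite mM/=; apply: m_ge => p Cp.
  by rewrite (sqn_sqr (CN p Cp)) ler_pM ?m0// m_le.
Qed.

Lemma exists_minimal_square_seminorm N a : square_seminorm N N ->
  exists p, [/\ square_seminorm N p, p a = N a &
    forall q, square_seminorm N q -> q a = N a -> (forall x, q x <= p x) ->
      q = p].
Proof.
move=> SN; pose T := {p : A -> R | square_seminorm N p /\ p a = N a}.
pose r (p q : T) := `[< forall x, sval q x <= sval p x >].
have rP (p q : T) : reflect (forall x, sval q x <= sval p x) (r p q).
  exact: asboolP.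
have [||||t tmin] := @Zorn T r.
- by move=> p; apply/rP.
- by move=> p q s /rP pq /rP qs; apply/rP => x; exact: le_trans (qs x) (pq x).
- move=> [p Pp] [q Pq] /rP /= pq /rP /= qp; apply: eq_exist => /=.
  by apply/funext => x; apply/le_anti; rewrite pq qp.
- move=> C Ctot; have [[p0 Cp0]|C0] := pselect (exists p : T, C p); last first.
    by exists (exist _ N (conj SN erefl)) => p Cp; case: C0; exists p.
  pose C' := [set sval p | p in C].
  have PS : square_seminorm N (fun x => inf [set p x | p in C']).
    apply: chain_inf_square_seminorm.
    + by exists (sval p0), p0.
    + by move=> _ [p _ <-]; exact: (svalP p).1.
    + move=> _ _ [p Cp <-] [q Cq <-].
      by have [/rP h|/rP h] := Ctot p q Cp Cq; [right|left].
  have PSa : inf [set p a | p in C'] = N a.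
    rewrite (_ : [set p a | p in C'] = [set N a]) ?inf1//.
    apply/seteqP; split=> [_ [_ [p _ <-] <-]|_ ->]; first exact: (svalP p).2.
    by exists (sval p0); [exists p0|exact: (svalP p0).2].
  have P := conj PS PSa; pose m : T := exist _ (fun x => inf _) P.
  exists m => p Cp; apply/rP => x; apply: (@inf_lb _ _ 0).
    by move=> _ [_ [q _ <-] <-]; exact: (sqn_ge0 (svalP q).1).
  by exists (sval p) => //; exists p.
have [Pp pa] := svalP t; exists (sval t); split=> // q Pq qa qp.
have P : square_seminorm N q /\ q a = N a by [].
pose q' : T := exist _ q P.
by have /tmin <- : r t q' by apply/rP.
Qed.

(** A minimal seminorm p with p a = N a is multiplicative. Smoothing by a keeps
    the value at a, so by minimality it changes nothing, that is,
    p (x * a) = p x * p a. This identity shows that smoothing by any other b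
    also keeps the value at a, and minimality applies to b in turn. *)
Lemma exists_multiplicative_seminorm N a : square_seminorm N N -> N a != 0 ->
  exists p, [/\ square_seminorm N p, p a = N a &
                forall x y, p (x * y) = p x * p y].
Proof.
move=> SN Na; have [p [Pp pa pmin]] := exists_minimal_square_seminorm a SN.
have pa0 : p a != 0 by rewrite pa.
have Ma x : p (x * a) = p x * p a.
  have E : smoothing p a = p.
    apply: pmin => [|| x']; first exact: smoothing_square_seminorm.
      rewrite (smoothing_fix Pp)// => n.
      by rewrite -exprS (sqnX _ Pp)// exprS.
    exact: (smoothing_le _ Pp).
  apply/le_anti; rewrite (sqnM Pp)/=.
  by have := smoothing_ge Pp pa0 x; rewrite E.
exists p; split=> // x y.
have [y0|y0] := eqVneq (p y) 0.
  by apply/le_anti; rewrite (sqnM Pp)/= y0 mulr0 (sqn_ge0 Pp).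
have E : smoothing p y = p.
  apply: pmin => [||x']; first exact: smoothing_square_seminorm.
    rewrite (smoothing_fix Pp)// => n.
    by rewrite mulrC Ma (sqnX _ Pp)// mulrC.
  exact: (smoothing_le _ Pp).
apply/le_anti; rewrite (sqnM Pp)/=.
by have := smoothing_ge Pp y0 x; rewrite E.
Qed.

End SquareSeminorms.

(** * Absolute values and finite-dimensional spaces *)

Lemma cvg_sumr {R : realType} {T : Type} (G : set_system T) {FG : Filter G} n
    (f : 'I_n -> T -> R) (l : 'I_n -> R) :
  (forall i, f i t @[t --> G] --> l i) ->
  \sum_i f i t @[t --> G] --> \sum_i l i.
Proof.
move=> fl.
by apply: (@cvg_big _ _ +%R 0 xpredT add_continuous) => i _.
Qed.

(* keeps v x folded, for the lemmas below to apply after simplification *)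
Arguments group_norm_fun : simpl never.

Section AbsvalTheory.
Context {R : realType} {F : fieldType} (v : absval R F).

Lemma av_ge0 x : 0 <= v x. Proof. exact: absval_ge0. Qed.
Lemma av0 : v 0 = 0. Proof. exact/absval_eq0. Qed.
Lemma av_eq0 x : v x = 0 -> x = 0. Proof. by move/absval_eq0. Qed.
Lemma av1 : v 1 = 1. Proof. exact: absval1. Qed.
Lemma avN x : v (- x) = v x. Proof. exact: absvalN. Qed.
Lemma avM x y : v (x * y) = v x * v y. Proof. exact: absvalM. Qed.
Lemma avD x y : v (x + y) <= v x + v y. Proof. exact: absvalD. Qed.
Lemma avX x n : v (x ^+ n) = v x ^+ n.
Proof. by elim: n => [|n IH]; rewrite ?expr0 ?av1// !exprS avM IH. Qed.
Lemma av_gt0 x : x != 0 -> 0 < v x.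
Proof.
by move=> x0; rewrite lt_def av_ge0 andbT; apply: contra_neq x0 => /av_eq0.
Qed.
Lemma avV x : x != 0 -> v x^-1 = (v x)^-1.
Proof.
move=> x0; have vx := av_gt0 x0; apply: (mulIf (lt0r_neq0 vx)).
by rewrite -avM !mulVf ?av1// gt_eqF.
Qed.
Lemma av_distC x y : v (x - y) = v (y - x).
Proof. by rewrite -avN opprB. Qed.

End AbsvalTheory.

(** The constant does not grow with the power: by Bernoulli's inequality,
    (s / t) ^ n would exceed C if s / t were greater than 1. *)
Lemma le_of_exp_le {R : realType} (C s t : R) : 0 <= s -> 0 <= t ->
  (forall n, s ^+ n <= C * t ^+ n) -> s <= t.
Proof.
move=> s0 t0 h; rewrite leNgt; apply/negP => ts.
have [t00|t00] := eqVneq t 0.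
  have := h 1%N; rewrite !expr1 t00 mulr0 => s0'.
  by have := lt_le_trans ts s0'; rewrite t00 ltxx.
have tp : 0 < t by rewrite lt_def t00.
pose r := s / t - 1.
have r0 : 0 < r by rewrite subr_gt0 ltr_pdivlMr// mul1r.
have rE : s / t = 1 + r by rewrite /r addrCA subrr addr0.
have bern n : 1 + n%:R * r <= (s / t) ^+ n.
  elim: n => [|n IH]; first by rewrite mul0r addr0 expr0.
  rewrite exprS {1}rE.
  apply: (@le_trans _ _ ((1 + r) * (1 + n%:R * r))); last first.
    by rewrite ler_pM2l// addr_gt0.
  have : 0 <= n%:R * (r * r) by rewrite !mulr_ge0 // ltW.
  by rewrite -natr1; lra.
have bnd n : n%:R * r <= C.
  apply: le_trans (_ : (s / t) ^+ n <= C); last first.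
    by rewrite expr_div_n ler_pdivrMr ?exprn_gt0.
  by apply: le_trans (bern n); rewrite lerDr.
have : C / r < (Num.trunc (C / r)).+1%:R := truncnS_gt _.
by rewrite ltr_pdivrMr// ltNge bnd.
Qed.

Section FiniteFamilies.
Context {R : realType} {F : fieldType} (v : absval R F).
Context (F_complete : metric_complete v setT).
Context (V : lmodType F) (N : V -> R).
Context (N0 : forall x, N x = 0 -> x = 0).
Context (ND : forall x y, N (x + y) <= N x + N y).
Context (NZ : forall (c : F) x, N (c *: x) = v c * N x).

Let Nz : N 0 = 0. Proof. by rewrite -(scale0r 0) NZ av0 mul0r. Qed.
Let NN x : N (- x) = N x.
Proof. by rewrite -scaleN1r NZ avN av1 mul1r. Qed.
Let Nge0 x : 0 <= N x.
Proof. by have := ND x (- x); rewrite subrr NN Nz; lra. Qed.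

Lemma subadd_sum n (c : 'I_n -> F) (e : 'I_n -> V) :
  N (\sum_i c i *: e i) <= \sum_i v (c i) * N (e i).
Proof.
elim/big_ind2: _ => [|x1 x2 y1 y2 h1 h2|i _]; rewrite ?Nz ?NZ//.
by apply: le_trans (ND _ _) _; exact: lerD.
Qed.

(** Equivalence of norms in finite dimension, by induction on the number of
    vectors. The span of the last n vectors is complete, its norm being
    equivalent to the norm of the coordinates; hence the first vector, which
    lies outside of it, has a positive distance d to it, and this bounds the
    first coordinate. *)
Lemma bounded_coordinates n (e : 'I_n -> V) :
  (forall c : 'I_n -> F, \sum_i c i *: e i = 0 -> forall i, c i = 0) ->
  exists2 C, 0 < C & forall c i, v (c i) <= C * N (\sum_i c i *: e i).
Proof.
elim: n e => [|n IH] e free_e; first by exists 1 => // c [].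
pose e' i := e (lift ord0 i).
have [|C C0 HC] := IH e'.
  move=> c c0 i.
  pose c1 j := if unlift ord0 j is Some k then c k else 0.
  have := free_e c1; rewrite big_ord_recl {1}/c1 unlift_none scale0r add0r.
  under eq_bigr do rewrite /c1 liftK.
  by move=> /(_ c0 (lift ord0 i)); rewrite /c1 liftK.
have [d d0 Hd] : exists2 d, 0 < d &
    forall c : 'I_n -> F, d <= N (e ord0 + \sum_i c i *: e' i).
  apply: contrapT => nd.
  have /choice[c Hc] (k : nat) : exists c : 'I_n -> F,
      N (e ord0 + \sum_i c i *: e' i) < k.+1%:R^-1.
    apply: contrapT => nc; apply: nd; exists k.+1%:R^-1.
      by rewrite invr_gt0.
    by move=> c; rewrite leNgt; apply/negP => h; apply: nc; exists c.
  have Hl i : exists l, v (c k i - l) @[k --> \oo] --> (0 : R).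
    have [//|eps eps0|l _ cl] := F_complete (u := fun k => c k i);
      last by exists l.
    have e1 : 0 < eps / C / 2 by rewrite !divr_gt0.
    have [m _ Hm] := near_infty_natSinv_lt (PosNum e1).
    exists m => p q mp mq.
    have := HC (fun j => c p j - c q j) i; move=> /le_lt_trans; apply.
    rewrite -ltr_pdivlMl// mulrC.
    have -> : \sum_i (c p i - c q i) *: e' i =
      (e ord0 + \sum_i c p i *: e' i) - (e ord0 + \sum_i c q i *: e' i).
      rewrite opprD addrACA subrr add0r -sumrB.
      by apply: eq_bigr => j _; rewrite scalerBl.
    apply: le_lt_trans (ND _ _) _; rewrite NN [ltRHS]splitr ltrD//.
      exact: lt_trans (Hc p) (Hm p mp).
    exact: lt_trans (Hc q) (Hm q mq).
  have /choice[l {}Hl] := Hl.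
  have z0 : N (e ord0 + \sum_i l i *: e' i) = 0.
    apply/le_anti; rewrite Nge0 andbT.
    apply: (ge_cvg (G := \oo) (u := fun k =>
        k.+1%:R^-1 + \sum_(i < n) v (c k i - l i) * N (e' i))).
      have H i : v (c k i - l i) * N (e' i) @[k --> \oo] --> 0 * N (e' i).
        by apply: cvgMr_tmp; exact: Hl.
      have E : 0 + \sum_i 0 * N (e' i) = 0 :> R.
        by rewrite big1 ?addr0// => i _; rewrite mul0r.
      rewrite -[X in _ --> X]E.
      apply: cvgD; [exact: cvg_harmonic|exact: (cvg_sumr H)].
    move=> k.
    have -> : e ord0 + \sum_i l i *: e' i =
       (e ord0 + \sum_i c k i *: e' i) + \sum_i (l i - c k i) *: e' i.
      rewrite -addrA -big_split/=; congr (_ + _).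
      by apply: eq_bigr => j _; rewrite -scalerDl addrC subrK.
    apply: le_trans (ND _ _) _; apply: lerD; first exact/ltW/Hc.
    apply: le_trans (subadd_sum _ _) _.
    by apply: ler_sum => j _; rewrite av_distC.
  pose c1 j := if unlift ord0 j is Some k then l k else 1.
  have := free_e c1; rewrite big_ord_recl {1}/c1 unlift_none scale1r.
  under eq_bigr do rewrite /c1 liftK.
  move=> /(_ (N0 z0) ord0); rewrite /c1 unlift_none => /eqP.
  by rewrite oner_eq0.
pose C' := d^-1 + C * (1 + N (e ord0) / d).
have Cpos : 0 < C * (1 + N (e ord0) / d).
  by rewrite mulr_gt0// ltr_pwDl// divr_ge0// ltW.
have dpos : 0 < d^-1 by rewrite invr_gt0.
exists C'; first exact: addr_gt0.
move=> c i; set x := \sum_i _.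
have xE : x = c ord0 *: e ord0 + \sum_i c (lift ord0 i) *: e' i.
  by rewrite /x big_ord_recl.
have c0 : v (c ord0) <= N x / d.
  rewrite ler_pdivlMr//; have [->|c00] := eqVneq (c ord0) 0.
    by rewrite av0 mul0r.
  have -> : x = c ord0 *: (e ord0 + \sum_i (c (lift ord0 i) / c ord0) *: e' i).
    rewrite xE scalerDr scaler_sumr; congr (_ + _).
    by apply: eq_bigr => j _; rewrite scalerA mulrC divfK.
  by rewrite NZ ler_wpM2l ?av_ge0.
rewrite /C' mulrDl; case: (unliftP ord0 i) => [j|] ->.
  apply: (le_trans (HC (fun i => c (lift ord0 i)) j)).
  have -> : \sum_(i < n) c (lift ord0 i) *: e' i = x + (- c ord0) *: e ord0.
    by rewrite xE addrAC scaleNr subrr add0r.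
  apply: ler_wpDl; first by rewrite mulr_ge0// ltW.
  rewrite -mulrA ler_pM2l//.
  apply: le_trans (ND _ _) _; rewrite NZ avN mulrDl mul1r lerD2l.
  rewrite (_ : N (e ord0) / d * N x = N x / d * N (e ord0)); last by ring.
  by rewrite ler_wpM2r.
apply: le_trans c0 _; rewrite mulrC lerDl.
by rewrite mulr_ge0// ltW.
Qed.

End FiniteFamilies.

(** * Finite extensions of a complete valued field *)

Section FiniteExtension.
Context {R : realType} {F : fieldType} {v : absval R F}.
Context (F_complete : metric_complete v setT).
Context {L : fieldExtType F} {w : absval R L} (w_ext : valued_extension v w).

Lemma ext_avZ c x : w (c *: x) = v c * w x.
Proof. by rewrite -mulr_algl avM w_ext. Qed.

Let b := vbasis {:L}.

Lemma vbasis_coord x : x = \sum_i coord b i x *: b`_i.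
Proof. by apply: coord_vbasis; exact: memvf. Qed.

Lemma coord_bounded : exists2 C, 0 < C &
  forall x i, v (coord b i x) <= C * w x.
Proof.
have fb : free b := basis_free (vbasisP _).
have [|C C0 HC] := bounded_coordinates F_complete (@av_eq0 _ _ w)
  (@avD _ _ w) ext_avZ (e := fun i : 'I_(\dim {:L}) => b`_i).
  by move=> c c0; have /freeP := fb; apply.
by exists C => // x i; rewrite {2}(vbasis_coord x); exact: HC.
Qed.

Lemma seminorm_bounded (t : L -> R) :
  (forall x y, t (x + y) <= t x + t y) ->
  (forall (c : F) x, t (c *: x) = v c * t x) ->
  exists C, forall x, t x <= C * w x.
Proof.
move=> tD tZ; have [C C0 HC] := coord_bounded.
have t0 x : 0 <= t x.
  have tN : t (- x) = t x by rewrite -scaleN1r tZ avN av1 mul1r.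
  have t00 : t 0 = 0 by rewrite -(scale0r 0) tZ av0 mul0r.
  by have := tD x (- x); rewrite subrr tN t00; lra.
exists (\sum_(i < \dim {:L}) C * t b`_i) => x.
rewrite {1}(vbasis_coord x) mulr_suml.
apply: le_trans (subadd_sum tD tZ _ _) _; apply: ler_sum => i _.
by rewrite mulrAC ler_wpM2r.
Qed.

(** The comparison t <= C * w applied to the powers of x removes C. *)
Lemma le_absval_ext (t : L -> R) :
  (forall x, 0 <= t x) ->
  (forall x y, t (x + y) <= t x + t y) ->
  (forall x y, t (x * y) = t x * t y) ->
  (forall c : F, t c%:A = v c) ->
  forall x, t x <= w x.
Proof.
move=> t0 tD tM tZ x.
have [||C HC] := @seminorm_bounded t => //.
  by move=> c y; rewrite -mulr_algl tM tZ.
apply: (@le_of_exp_le _ C) => // [|n]; first exact: av_ge0.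
have -> : t x ^+ n = t (x ^+ n).
  elim: n => [|n IH]; first by have := tZ 1; rewrite !expr0 scale1r av1.
  by rewrite !exprS tM IH.
by rewrite -avX.
Qed.

(** The reverse inequality is the previous one at the inverse of x. *)
Lemma absval_ext_unique (t : L -> R) :
  (forall x, 0 <= t x) ->
  (forall x y, t (x + y) <= t x + t y) ->
  (forall x y, t (x * y) = t x * t y) ->
  (forall c : F, t c%:A = v c) ->
  t =1 w.
Proof.
move=> t0 tD tM tZ x; apply/le_anti; rewrite le_absval_ext//=.
have [->|x0] := eqVneq x 0; first by rewrite av0 t0.
have t1 : t x * t x^-1 = 1 by have := tZ 1; rewrite scale1r av1 -tM mulfV.
have tx : 0 < t x.
  rewrite lt_def t0 andbT; apply/eqP => tx0.
  by move: t1; rewrite tx0 mul0r => /eqP; rewrite eq_sym oner_eq0.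
have : t x^-1 <= w x^-1 by exact: le_absval_ext.
rewrite avV// -[t x^-1](mulKf (lt0r_neq0 tx)) t1 mulr1.
by rewrite lef_pV2// posrE av_gt0.
Qed.

Lemma coord_cvg {T : Type} (G : set_system T) {FG : Filter G} (f : T -> L)
    (l : 'I_(\dim {:L}) -> F) :
  (forall i, v (coord b i (f t) - l i) @[t --> G] --> (0 : R)) ->
  w (f t - \sum_i l i *: b`_i) @[t --> G] --> (0 : R).
Proof.
move=> fl.
have H i : v (coord b i (f t) - l i) * w b`_i @[t --> G] --> 0 * w b`_i.
  by apply: cvgMr_tmp; exact: fl.
have H0 : \sum_(i < \dim {:L}) v (coord b i (f t) - l i) * w b`_i
    @[t --> G] --> (0 : R).
  have E : \sum_(i < \dim {:L}) 0 * w b`_i = 0 :> R.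
    by rewrite big1// => i _; rewrite mul0r.
  by rewrite -[X in _ --> X]E; exact: (cvg_sumr H).
apply: squeeze_cvgr (cvg_cst 0) H0; apply: nearW => t; rewrite av_ge0/=.
have -> : f t - \sum_i l i *: b`_i = \sum_i (coord b i (f t) - l i) *: b`_i.
  rewrite {1}(vbasis_coord (f t)) -sumrB.
  by apply: eq_bigr => i _; rewrite scalerBl.
exact: (subadd_sum (@avD _ _ w) ext_avZ).
Qed.

Lemma ext_complete : metric_complete w setT.
Proof.
move=> u _ Cu; have [C C0 HC] := coord_bounded.
have /choice[l Hl] i :
    exists l, v (coord b i (u k) - l) @[k --> \oo] --> (0 : R).
  have [//|e e0|l _ cl] := F_complete (u := fun k => coord b i (u k));
    last by exists l.
  have [|n Hn] := Cu (e / C); first by rewrite divr_gt0.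
  exists n => p q np nq; rewrite -raddfB; apply: le_lt_trans (HC _ _) _.
  by rewrite mulrC -ltr_pdivlMr// Hn.
by exists (\sum_i l i *: b`_i) => //; exact: coord_cvg.
Qed.

End FiniteExtension.

Section FunctionOrder.
Context {T : Type} (f : T -> T).

Lemma iter_mulC n k : iter n f =1 id -> iter (k * n) f =1 id.
Proof. by move=> fn; elim: k => [//|k IH] x; rewrite mulSn iterD IH fn. Qed.

Lemma order_dvd n : (0 < n)%N -> iter n f =1 id ->
  exists2 m, is_order f m & (m %| n)%N.
Proof.
move=> n0 fn.
have exN : exists m, (0 < m)%N && `[< iter m f =1 id >].
  by exists n; rewrite n0; apply/asboolP.
case: (ex_minnP exN) => m /andP[m0 /asboolP fm] mmin.
exists m.
  by split=> // k k0 fk; apply: mmin; rewrite k0; exact/asboolP.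
rewrite /dvdn; apply: contraT; rewrite -lt0n => r0.
suff : (m <= n %% m)%N by rewrite leqNgt ltn_pmod.
apply: mmin; rewrite r0; apply/asboolP => x.
by have := fn x; rewrite {1}(divn_eq n m) addnC iterD iter_mulC.
Qed.

End FunctionOrder.

Section GaloisAut.
Context {F : fieldType} {L : fieldExtType F} (g : 'End(L)) (gG : Galois_aut g).

Lemma Galois_monoid : monoid_morphism g.
Proof. by apply/kHom_monoid_morphism; have /andP[] := gG. Qed.

Lemma Galois1 : g 1 = 1. Proof. by case: Galois_monoid. Qed.
Lemma GaloisM x y : g (x * y) = g x * g y.
Proof. by case: Galois_monoid => _ ->. Qed.
Lemma Galois_alg (c : F) : g c%:A = c%:A.
Proof. by rewrite linearZ/= Galois1. Qed.
Lemma Galois_inj : injective g.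
Proof.
move=> x y /eqP; rewrite -subr_eq0 -raddfB; apply: contraTeq.
rewrite -subr_eq0 => xy; apply/eqP => g0.
have : g ((x - y) * (x - y)^-1) = 1 by rewrite mulfV// Galois1.
rewrite GaloisM g0 mul0r => /eqP.
by rewrite eq_sym oner_eq0.
Qed.

(** All iterates of x are roots of its minimal polynomial. *)
Lemma Galois_orbit_finite x : exists2 n, (0 < n)%N & iter n g x = x.
Proof.
pose p := minPoly 1 x.
have rp k : root p (iter k g x).
  elim: k => [|k IH]; first exact: root_minPoly.
  have hg : kHom 1 {:L} g by have /andP[] := gG.
  rewrite iterS; apply: (kHom_root_id (sub1v _) hg) => //.
    exact: minPolyOver.
  exact: memvf.
have : ~~ uniq (traject g x (size p)).
  apply/negP => up.
  have := max_poly_roots (monic_neq0 (monic_minPoly 1 x)) _ up.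
  rewrite size_traject ltnn => h; suff : false by []; apply: h.
  by apply/allP => _ /trajectP[k _ ->].
move=> /(uniqPn x)[i [j [ij]]]; rewrite size_traject => jp.
rewrite !nth_traject// ?(ltn_trans ij)// => gij.
exists (j - i)%N; first by rewrite subn_gt0.
have iterI k : injective (iter k g).
  by elim: k => [//|k IH] y z /Galois_inj/IH.
by apply: (iterI i); rewrite -iterD subnKC// ltnW.
Qed.

(** An iterate that fixes a basis is the identity. *)
Lemma Galois_finite_order : exists n, is_order g n.
Proof.
have /choice[n Hn] (i : 'I_(\dim {:L})) :
    exists n, (0 < n)%N /\ iter n g (vbasis {:L})`_i = (vbasis {:L})`_i.
  by have [n n0 gn] := Galois_orbit_finite (vbasis {:L})`_i; exists n.
pose N := (\prod_i n i)%N.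
have N0 : (0 < N)%N by apply: prodn_gt0 => i; case: (Hn i).
have gN x : iter N g x = x.
  have iterL m (c : 'I_(\dim {:L}) -> F) (e : 'I_(\dim {:L}) -> L) :
      iter m g (\sum_i c i *: e i) = \sum_i c i *: iter m g (e i).
    elim: m => [//|m IH]; rewrite iterS IH linear_sum.
    by apply: eq_bigr => i _; rewrite linearZ.
  rewrite {1}(vbasis_coord x) iterL [RHS]vbasis_coord.
  apply: eq_bigr => i _; congr (_ *: _).
  rewrite /N (bigD1 i)//= mulnC; case: (Hn i) => _.
  by elim: (\prod_(_ | _) _)%N => [//|k IH] gi; rewrite mulSn iterD IH gi.
by have [m om _] := order_dvd N0 gN; exists m.
Qed.

End GaloisAut.

(** * Characters with values in a finite extension *)

Section Characters.
Context {F : fieldType} {A : comAlgType F} {L : fieldExtType F}.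

Record is_character (phi : A -> L) : Prop := IsCharacter {
  charD : forall a b, phi (a + b) = phi a + phi b;
  charM : forall a b, phi (a * b) = phi a * phi b;
  char1 : phi 1 = 1;
  charZ : forall c a, phi (c *: a) = c *: phi a
}.

Context (phi : A -> L) (phiC : is_character phi).

Lemma char0 : phi 0 = 0.
Proof. by rewrite -(scale0r 0) (charZ phiC) scale0r. Qed.

Lemma charB a b : phi (a - b) = phi a - phi b.
Proof. by rewrite -scaleN1r (charD phiC) (charZ phiC) scaleN1r. Qed.
Lemma charX a n : phi (a ^+ n) = phi a ^+ n.
Proof.
by elim: n => [|n IH]; rewrite ?expr0 ?(char1 phiC)// !exprS (charM phiC) IH.
Qed.
Lemma char_sum n (c : 'I_n -> F) (e : 'I_n -> A) :
  phi (\sum_i c i *: e i) = \sum_i c i *: phi (e i).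
Proof.
apply: (big_ind2 (fun x y => phi x = y)) => [|x1 x2 y1 y2 <- <-|i _].
- exact: char0.
- exact: (charD phiC).
- exact: (charZ phiC).
Qed.

Lemma char_horner a (p : {poly F}) :
  exists b, phi b = (map_poly (in_alg L) p).[phi a].
Proof.
elim/poly_ind: p => [|p c [b IH]].
  by exists 0; rewrite rmorph0 horner0 char0.
exists (b * a + c%:A).
rewrite (charD phiC) (charM phiC) (charZ phiC) (char1 phiC) IH.
rewrite rmorphD rmorphM/= map_polyX map_polyC.
by rewrite hornerD hornerM hornerX hornerC.
Qed.

(** The inverse of [phi a] is a polynomial in [phi a], as L is algebraic over F;
    so the image of a character is a subfield. *)
Lemma char_inverse a : phi a != 0 -> exists b, phi a * phi b = 1.
Proof.
move=> a0; have : (phi a)^-1 \in <<1; phi a>>%VS by rewrite rpredV memv_adjoin.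
move=> /Fadjoin1_polyP[p pE]; have [b bE] := char_horner a p.
by exists b; rewrite bE -pE mulfV.
Qed.

(** A free family of values of phi of maximal size spans all values; its size is
    bounded by the dimension of L. *)
Lemma char_span : exists n (e : 'I_n -> A),
  (forall c : 'I_n -> F, \sum_i c i *: phi (e i) = 0 -> forall i, c i = 0) /\
  forall a, exists c : 'I_n -> F, phi a = \sum_i c i *: phi (e i).
Proof.
pose P n := `[< exists2 s : seq A, size s = n & free (map phi s) >].
have exP : exists n, P n.
  by exists 0%N; apply/asboolP; exists [::] => //; exact: nil_free.
have ubP n : P n -> (n <= \dim {:L})%N.
  move=> /asboolP[s <-]; rewrite /free size_map => /eqP <-.
  by apply: dimvS; exact: subvf.
case: (ex_maxnP exP ubP) => n /asboolP[s ss sfree] smax.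
have st : size (map phi s) == n by rewrite size_map ss.
pose t := Tuple st.
have te (i : 'I_n) : t`_i = phi s`_i by rewrite /= (nth_map 0)// ss.
exists n, (fun i => s`_i); split=> [c|a].
  under eq_bigr do rewrite -te.
  have ft : free t by [].
  by have /freeP := ft; apply.
have at_ : phi a \in <<t>>%VS.
  apply: contraT => aN; have := smax n.+1; rewrite ltnn; apply.
  apply/asboolP; exists (a :: s); first by rewrite /= ss.
  by rewrite /= free_cons aN.
exists (fun i => coord t i (phi a)); rewrite {1}(coord_span at_).
by apply: eq_bigr => i _; rewrite te.
Qed.

End Characters.

Section SeminormCharacter.
Context {R : realType} {F : fieldType} {v : absval R F}.
Context (F_complete : metric_complete v setT).
Context {L : fieldExtType F} {w : absval R L} (w_ext : valued_extension v w).
Context {A : comAlgType F} (s : A -> R) (phi : A -> L).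
Context (s_ge0 : forall a, 0 <= s a).
Context (sD : forall a b, s (a + b) <= s a + s b).
Context (sM : forall a b, s (a * b) = s a * s b).
Context (sZ : forall (c : F) a, s (c *: a) = v c * s a).
Context (s1 : s 1 = 1) (phiC : is_character phi).
Context (s_ker : forall a, phi a = 0 -> s a = 0).

Let s0 : s 0 = 0. Proof. exact: s_ker (char0 phiC). Qed.

Let s_congr a b : phi a = phi b -> s a = s b.
Proof.
suff H x y : phi x = phi y -> s x <= s y.
  by move=> ab; apply/le_anti; rewrite !H.
move=> xy; rewrite -(subrK y x); apply: le_trans (sD _ _) _.
by rewrite s_ker ?add0r// (charB phiC) xy subrr.
Qed.

(** With phi a written in a basis of values phi (e i), the element a is the same
    combination of the e i up to the kernel of s, and the coordinates are
    bounded by w (phi a). Hence s <= D * (w \o phi), and passing to powers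
    removes the constant. *)
Lemma seminorm_le_char a : s a <= w (phi a).
Proof.
have [n [e [efree espan]]] := char_span phi.
have [C C0 HC] := bounded_coordinates F_complete (@av_eq0 _ _ w)
  (@avD _ _ w) (ext_avZ w_ext) efree.
pose D := \sum_i C * s (e i).
have bnd b : s b <= D * w (phi b).
  have [c bE] := espan b.
  rewrite (s_congr (b := \sum_i c i *: e i)) ?(char_sum phiC)//.
  rewrite /D mulr_suml; apply: le_trans (subadd_sum sD sZ _ _) _.
  by apply: ler_sum => i _; rewrite mulrAC ler_wpM2r// bE.
apply: (@le_of_exp_le _ D) => // [|n']; first exact: av_ge0.
have -> : s a ^+ n' = s (a ^+ n').
  by elim: n' => [|k IH]; rewrite ?expr0 ?s1// !exprS sM IH.
by rewrite -avX -(charX phiC).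
Qed.

(** The reverse inequality comes from an inverse of a modulo the kernel. *)
Lemma seminorm_eq_char a : s a = w (phi a).
Proof.
apply/le_anti; rewrite seminorm_le_char/=.
have [a0|a0] := eqVneq (phi a) 0; first by rewrite a0 av0 s_ge0.
have [b ab] := char_inverse phiC a0.
have sab : s a * s b = 1.
  by rewrite -sM (s_congr (b := 1)) ?s1// (charM phiC) ab (char1 phiC).
have wab : w (phi a) * w (phi b) = 1 by rewrite -avM ab av1.
have sb : s b <= w (phi b) by exact: seminorm_le_char.
have wa := av_gt0 w a0.
have sb0 : 0 < s b.
  rewrite lt_def s_ge0 andbT; apply/eqP => h.
  by move: sab; rewrite h mulr0 => /eqP; rewrite eq_sym oner_eq0.
rewrite -(ler_pM2r sb0) sab -wab.
by rewrite ler_pM2l.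
Qed.

End SeminormCharacter.

(** * From seminorms to characters *)

Section BanachNorm.
Context {R : realType} {F : fieldType} {v : absval R F} {A : comAlgType F}.
Context (nA : banach_norm v A).

Lemma bn_ge0 a : 0 <= nA a. Proof. exact: banach_norm_ge0. Qed.
Lemma bn0 : nA 0 = 0. Proof. exact/banach_norm_eq0. Qed.
Lemma bn_eq0 a : nA a = 0 -> a = 0. Proof. by move/banach_norm_eq0. Qed.
Lemma bn1 : nA 1 = 1. Proof. exact: banach_norm1. Qed.
Lemma bnD a b : nA (a + b) <= nA a + nA b. Proof. exact: banach_normD. Qed.
Lemma bnM a b : nA (a * b) <= nA a * nA b. Proof. exact: banach_normM. Qed.
Lemma bnZ (c : F) a : nA (c *: a) = v c * nA a. Proof. exact: banach_normZ. Qed.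

End BanachNorm.

Section MulSeminorm.
Context {R : realType} {F : fieldType} {v : absval R F} {A : comAlgType F}.
Context {nA : banach_norm v A} {s : A -> R} (sP : bounded_mul_seminorm nA s).

Lemma mseminorm1 : s 1 = 1.
Proof.
have [a sa] := seminorm_nonzero sP; apply: (mulIf (x := s a)); first exact/eqP.
by rewrite -(seminormM sP) !mul1r.
Qed.

Lemma mseminorm_alg_le (c : F) : s c%:A <= v c.
Proof.
by apply: le_trans (seminorm_le sP _) _; rewrite bnZ bn1 mulr1.
Qed.

(** s <= v on scalars, for c and for its inverse. *)
Lemma mseminormZ (c : F) a : s (c *: a) = v c * s a.
Proof.
rewrite -mulr_algl (seminormM sP); congr (_ * _).
apply/le_anti; rewrite mseminorm_alg_le andTb.
have [->|c0] := eqVneq c 0; first by rewrite av0 (seminorm_ge0 sP).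
have vc := av_gt0 v c0.
have : s c^-1%:A <= (v c)^-1 by rewrite -avV// mseminorm_alg_le.
have sc : s c%:A * s c^-1%:A = 1.
  by rewrite -(seminormM sP) mulr_algl scalerA mulfV// scale1r mseminorm1.
rewrite -(ler_pM2l vc) mulfV ?lt0r_neq0// => h.
rewrite -[leLHS]mulr1 -sc mulrCA -[leRHS]mulr1.
by rewrite ler_wpM2l// (seminorm_ge0 sP).
Qed.

Definition seminorm_kernel : pred A := fun a => `[< s a = 0 >].

Lemma kernelP a : reflect (s a = 0) (a \in seminorm_kernel).
Proof. exact: asboolP. Qed.

Lemma kernel_idealr : idealr_closed seminorm_kernel.
Proof.
split; first exact/kernelP/(seminorm0 sP).
  by apply/kernelP; rewrite mseminorm1; apply/eqP; exact: oner_neq0.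
move=> a x y /kernelP x0 /kernelP y0; apply/kernelP/le_anti.
rewrite (seminorm_ge0 sP) andbT; apply: le_trans (seminormD sP _ _) _.
by rewrite (seminormM sP) x0 y0 mulr0 addr0.
Qed.

Lemma kernel_prime : prime_idealr_closed seminorm_kernel.
Proof.
move=> x y /kernelP; rewrite (seminormM sP) => /eqP; rewrite mulf_eq0.
by move=> /orP[] /eqP h; apply/orP; [left|right]; apply/kernelP.
Qed.

Definition kernel_ideal : prime_idealr A :=
  HB.pack_for (prime_idealr A) seminorm_kernel
   (isIdealr.Build A seminorm_kernel kernel_idealr)
   (isPrimeIdealrClosed.Build A seminorm_kernel kernel_prime).

Lemma kernel_idealP a : a \in kernel_ideal <-> s a = 0.
Proof. by split=> [/kernelP|/kernelP]. Qed.

Lemma kernel_closed :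
  closed ([set a | a \in kernel_ideal] : set (metric_of nA)).
Proof.
move=> a /= cl_a; apply/kernel_idealP/le_anti.
rewrite (seminorm_ge0 sP) andbT; apply/ler_addgt0Pr => e e0.
have [b [/kernel_idealP sb /=]] :=
  cl_a (ball (a : metric_of nA) e) (nbhsx_ballx _ _ e0).
rewrite ballEmdist /= /mdist /= => ab.
rewrite add0r -(subrK b a); apply: le_trans (seminormD sP _ _) _.
by rewrite sb addr0 (le_trans (seminorm_le sP _))// ltW.
Qed.

End MulSeminorm.

Section QuotientProjection.
Context {A : comNzRingType} (J : prime_idealr A).
Local Notation Q := (prime_quot J).

(** The projection to the quotient is a ring morphism for the structure of
    [{ideal_quot J}], which [prime_quot J] shares up to conversion. *)
Definition to_prime_quot (a : A) : Q := \pi_Q%qT a.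

Lemma to_prime_quotD a b :
  to_prime_quot (a + b) = to_prime_quot a + to_prime_quot b.
Proof. exact: (rmorphD (\pi_({ideal_quot J})%qT)). Qed.
Lemma to_prime_quotM a b :
  to_prime_quot (a * b) = to_prime_quot a * to_prime_quot b.
Proof. exact: (rmorphM (\pi_({ideal_quot J})%qT)). Qed.
Lemma to_prime_quot1 : to_prime_quot 1 = 1.
Proof. exact: (rmorph1 (\pi_({ideal_quot J})%qT)). Qed.
Lemma to_prime_quot_eq0 a : to_prime_quot a = 0 <-> a \in J.
Proof.
have pi0 := rmorph0 (\pi_({ideal_quot J})%qT).
rewrite -[a in a \in J]subr0 Quotient.idealrBE; split=> [a0|/eqP a0].
  by apply/eqP; apply: etrans a0 (esym pi0).
exact: etrans a0 pi0.
Qed.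

End QuotientProjection.

Lemma seminorm_character {R : realType} {F : fieldType} {v : absval R F}
    {A : comAlgType F} {nA : banach_norm v A} {s : A -> R}
    (sP : bounded_mul_seminorm nA s) (L : fieldExtType F) :
  frac_embeds (kernel_ideal sP) L ->
  exists2 phi : A -> L, is_character phi & forall a, phi a = 0 -> s a = 0.
Proof.
move=> [K [h [hI _ hF]]].
pose q := to_prime_quot (kernel_ideal sP).
pose phi a : L := h (FracField.tofrac (q a)).
have phiM a b : phi (a * b) = phi a * phi b.
  by rewrite /phi /q to_prime_quotM !rmorphM.
have phi_alg c : phi c%:A = c%:A by exact: hF.
exists phi.
  split=> //.
  - by move=> a b; rewrite /phi /q to_prime_quotD !rmorphD.
  - by rewrite /phi /q to_prime_quot1 !rmorph1.
  - by move=> c a; rewrite -mulr_algl phiM phi_alg mulr_algl.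
move=> a /eqP; rewrite -(rmorph0 h) (inj_eq hI) tofrac_eq0.
by move=> /eqP/to_prime_quot_eq0/kernel_idealP.
Qed.

Section NormAttaining.
Context {R : realType} {F : fieldType} {v : absval R F}.
Context (F_complete : metric_complete v setT).
Context {L : fieldExtType F} {w : absval R L} (w_ext : valued_extension v w).
Context {A : comAlgType F} {nA : banach_norm v A}.
Context (A_square : forall a : A, nA (a ^+ 2) = nA a ^+ 2).
Context (embedding : forall J : prime_idealr A,
  closed ([set a | a \in J] : set (metric_of nA)) ->
  (exists2 s, bounded_mul_seminorm nA s & forall a, a \in J <-> s a = 0) ->
  frac_embeds J L).

Lemma norm_attained_seminorm a : a != 0 ->
  exists2 s, bounded_mul_seminorm nA s & s a = nA a.
Proof.
move=> a0.
have SN : square_seminorm nA nA.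
  split; [exact: bn_ge0|by []|exact: bnD|exact: bnM|].
  by move=> x; rewrite -!expr2 A_square.
have na0 : nA a != 0 by apply: contra_neq a0 => /bn_eq0.
have [s [Ss sa sM]] := exists_multiplicative_seminorm SN na0.
exists s => //; split.
- exact: (sqn_ge0 Ss).
- by exists a; rewrite sa; apply/eqP.
- exact: (sqn_le Ss).
- exact: sM.
- exact: (sqnD Ss).
- apply/le_anti; rewrite (sqn_ge0 Ss) andbT.
  by rewrite (le_trans (sqn_le Ss 0))// bn0.
Qed.

(** The residue field of the kernel of a seminorm attaining the norm at a embeds
    in L, which gives a character phi; the seminorm is then [w \o phi]. *)
Lemma norm_attained_char a : a != 0 ->
  exists phi : A -> L,
    [/\ is_character phi, forall b, w (phi b) <= nA b & w (phi a) = nA a].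
Proof.
move=> a0; have [s sP sa] := norm_attained_seminorm a0.
have [|phi phiC ker] := @seminorm_character _ _ _ _ _ _ sP L.
  apply: embedding; first exact: kernel_closed.
  by exists s => // b; exact: kernel_idealP.
have sE b : s b = w (phi b).
  apply: (seminorm_eq_char F_complete w_ext _ _ _ _ _ phiC ker).
  - exact: (seminorm_ge0 sP).
  - exact: (seminormD sP).
  - exact: (seminormM sP).
  - exact: (mseminormZ sP).
  - exact: (mseminorm1 sP).
exists phi; split=> // [b|]; last by rewrite -sE.
by rewrite -sE (seminorm_le sP).
Qed.

End NormAttaining.

(** * Convergence in normed groups and bounded ultrafilters *)

Section MetricConvergence.
Context {R : realType}.

Lemma cvg0_ltP {T : Type} (G : set_system T) {FG : Filter G} (h : T -> R) :
  (forall t, 0 <= h t) ->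
  h t @[t --> G] --> (0 : R) <-> forall e, 0 < e -> G [set t | h t < e].
Proof.
move=> h0; split=> [/cvgrPdist_lt hG e e0|hG].
  by apply: filterS (hG e e0) => t /=; rewrite sub0r normrN ger0_norm.
apply/cvgrPdist_lt => e e0; apply: filterS (hG e e0) => t /=.
by rewrite sub0r normrN ger0_norm.
Qed.

Section GroupNorm.
Context {V : zmodType} (N : group_norm R V).

Lemma gn_ge0 x : 0 <= N x.
Proof.
have N0 : N 0 = 0 by apply/group_norm_eq0.
by have := group_normD N x (- x); rewrite subrr N0 group_normN; lra.
Qed.

Lemma cvg_metricP {T : Type} (G : set_system T) {FG : Filter G}
    (f : T -> metric_of N) (l : metric_of N) :
  f t @[t --> G] --> l <-> N (f t - l) @[t --> G] --> (0 : R).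
Proof.
split=> [/cvg_ballP fG|].
  apply/cvg0_ltP => [t|e e0]; first exact: gn_ge0.
  apply: filterS (fG e e0) => t; rewrite ballEmdist /= /mdist /=.
  by rewrite -opprB group_normN.
move=> /cvg0_ltP fG; apply/cvg_ballP => e e0.
have {}fG := fG (fun t => gn_ge0 _) e e0.
apply: filterS fG => t /=; rewrite ballEmdist /= /mdist /=.
by rewrite -opprB group_normN.
Qed.

End GroupNorm.
End MetricConvergence.

Section BoundedUltrafilters.
Context {R : realType} {F : fieldType} {v : absval R F}.
Context (F_locally_compact : locally_compact [set: metric_of v]).
Context (F_nontrivial : nontrivial_absval v).

(** Powers of an element of absolute value less than 1. *)
Lemma small_scalar e : 0 < e -> exists2 c, c != 0 & v c < e.
Proof.
move=> e0.
have [x vx0 vx1] : exists2 x, x != 0 & v x < 1.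
  apply: contrapT => nx; apply: F_nontrivial => x.
  have [->|x0] := eqVneq x 0; first by left; exact: av0.
  right; apply/le_anti/andP; split; rewrite leNgt; apply/negP => h.
    apply: nx; exists x^-1; first by rewrite invr_eq0.
    by rewrite avV// invf_lt1// av_gt0.
  by apply: nx; exists x.
have /cvg0_ltP H : v x ^+ n @[n --> \oo] --> 0.
  by apply: cvg_expr; rewrite ger0_norm ?av_ge0.
have [|n _ /(_ n)/= Hn] := H _ e e0.
  by move=> n; rewrite exprn_ge0// av_ge0.
by exists (x ^+ n); rewrite ?expf_neq0// avX Hn.
Qed.

(** Multiplication by a small scalar c moves the values of f into a compact
    neighbourhood of 0, and a cluster point along an ultrafilter is a limit. *)
Lemma bounded_ultra_cvg {T : Type} (G : set_system T) (f : T -> F) (rho : R) :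
  UltraFilter G -> (forall t, v (f t) <= rho) ->
  exists l, v (f t - l) @[t --> G] --> (0 : R).
Proof.
move=> UG frho.
have [K nK [cK _]] := F_locally_compact (I : [set: metric_of v] (0 : F)).
have /nbhs_ballP[r /= r0 rK] : nbhs (0 : metric_of v) K.
  have nK' : nbhs (0 : metric_of v) [set x | [set: metric_of v] x -> K x].
    exact: nK.
  by apply: filterS nK' => x; apply.
have rho1 : 0 < Num.max rho 0 + 1 by rewrite ltr_wpDl// le_max lexx orbT.
have [c c0 vc] := small_scalar (divr_gt0 r0 rho1).
have vc0 := av_gt0 v c0.
pose h t : metric_of v := c * f t.
have hK t : K (h t).
  apply: rK; rewrite ballEmdist /= /mdist /= sub0r avN avM.
  have : v (f t) < Num.max rho 0 + 1.
    by apply: le_lt_trans (frho t) _; rewrite ltr_pwDr// le_max lexx.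
  rewrite ltr_pdivlMr// in vc => hf; apply: lt_trans vc.
  by rewrite ltr_pM2l.
have PG : ProperFilter (h t @[t --> G]) by exact: fmap_proper_filter.
have [|l [Kl cl]] := cK (h t @[t --> G]) PG; first exact: nearW.
exists (l / c); apply/cvg0_ltP => [t|e e0]; first exact: av_ge0.
have [//|GC] := in_ultra_setVsetC [set t | v (f t - l / c) < e] UG.
have e1 : 0 < v c * e by exact: mulr_gt0.
have [_ [[t Ct <-] /=]] := cl (h @` ~` [set t | v (f t - l / c) < e])
  (ball l (v c * e)) (filterS (fun t Ct => imageP h Ct) GC)
  (nbhsx_ballx _ _ e1).
rewrite ballEmdist /= /mdist /= => lt; case: Ct => /=.
rewrite -(ltr_pM2l vc0) -avM mulrBr mulrCA mulfV// mulr1.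
by rewrite av_distC.
Qed.

End BoundedUltrafilters.

(** * The compact space of bounded characters *)

Section CharacterSpace.
Context {R : realType} {F : fieldType} {v : absval R F}.
Context {L : fieldExtType F} (w : absval R L).
Context {A : comAlgType F} (nA : banach_norm v A).

Definition char_space : Type :=
  {phi : A -> L | is_character phi /\ forall a, w (phi a) <= nA a}.

HB.instance Definition _ := gen_eqMixin char_space.
HB.instance Definition _ := gen_choiceMixin char_space.

Definition gelfand (a : A) (x : char_space) : L := sval x a.
Local Notation evaluation a := (gelfand a : char_space -> metric_of w).

HB.instance Definition _ := Topological.copy char_space
  (sup_topology (fun a => Topological.class (initial_topology (evaluation a)))).

Lemma gelfand_char x : is_character (gelfand^~ x).
Proof. exact: (svalP x).1. Qed.

Lemma gelfandD a b x : gelfand (a + b) x = gelfand a x + gelfand b x.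
Proof. exact: (charD (gelfand_char x)). Qed.
Lemma gelfandM a b x : gelfand (a * b) x = gelfand a x * gelfand b x.
Proof. exact: (charM (gelfand_char x)). Qed.
Lemma gelfandZ c a x : gelfand (c *: a) x = c *: gelfand a x.
Proof. exact: (charZ (gelfand_char x)). Qed.
Lemma gelfand1 x : gelfand 1 x = 1.
Proof. exact: (char1 (gelfand_char x)). Qed.
Lemma gelfand0 x : gelfand 0 x = 0.
Proof. exact: (char0 (gelfand_char x)). Qed.
Lemma gelfandB a b x : gelfand (a - b) x = gelfand a x - gelfand b x.
Proof. exact: (charB (gelfand_char x)). Qed.

Lemma gelfand_le a x : w (gelfand a x) <= nA a.
Proof. exact: (svalP x).2. Qed.

Lemma char_space_ext x y : (forall a, gelfand a x = gelfand a y) -> x = y.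
Proof.
case: x y => [f Pf] [h Ph] fh; apply: eq_exist.
by apply/funext => a; exact: (fh a).
Qed.

(** The topology is the coarsest one making all evaluations continuous; it is
    used only through this criterion. *)
Lemma char_space_cvgP (G : set_system char_space) (x : char_space) : Filter G ->
  G --> x <-> forall a, evaluation a y @[y --> G] --> evaluation a x.
Proof.
move=> FG; rewrite (cvg_sup (fun a =>
  Topological.class (initial_topology (evaluation a)))).
split=> H a.
  pose ev : initial_topology (evaluation a) -> metric_of w := gelfand a.
  apply: (@cvg_trans _ (ev @ nbhs (x : initial_topology (evaluation a)))).
    by apply: cvg_app; exact: H.
  exact: initial_continuous.
move=> B /= [_ [[U oU <-] Ux UB]].
have : nbhs (evaluation a x) U by apply: open_nbhs_nbhs; split.
by move=> /(H a) GU; exact: (filterS UB GU).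
Qed.

Lemma gelfand_continuous a : continuous (evaluation a).
Proof. 
move=> x; have [h _] := @char_space_cvgP (nbhs x) x (nbhs_filter x).
by apply: h; exact: cvg_id.
Qed.

Lemma char_space_separated x y : x <> y ->
  exists a, gelfand a x <> gelfand a y.
Proof.
move=> xy; apply: contrapT => h; apply/xy/char_space_ext => a.
by apply: contrapT => axy; apply: h; exists a.
Qed.

Lemma char_space_hausdorff : hausdorff_space char_space.
Proof.
move=> x y cl; apply: char_space_ext => a.
have T2 : hausdorff_space (metric_of w) by exact: metric_hausdorff.
apply: T2 => U V Ux Vy.
have [z [zU zV]] := cl _ _ (gelfand_continuous Ux) (gelfand_continuous Vy).
by exists (gelfand a z).
Qed.

End CharacterSpace.

Arguments gelfand {R F v L w A nA} a x.

Section Compactness.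
Context {R : realType} {F : fieldType} {v : absval R F}.
Context (F_complete : metric_complete v setT).
Context (F_locally_compact : locally_compact [set: metric_of v]).
Context (F_nontrivial : nontrivial_absval v).
Context {L : fieldExtType F} {w : absval R L} (w_ext : valued_extension v w).
Context {A : comAlgType F} {nA : banach_norm v A}.

Local Notation X := (char_space w nA).

(** Along an ultrafilter, each coordinate of each value of the characters stays
    in a bounded set of F, so it converges; the pointwise limit phi inherits the
    identities defining a character and the bound by the norm. *)
Lemma char_space_compact : compact [set: X].
Proof.
rewrite compact_ultra => G UG _.
have PG : ProperFilter G := ultra_proper.
have [C C0 HC] := coord_bounded F_complete w_ext.
pose b := vbasis {:L}.
have /choice[phi Hphi] (a : A) : exists l : L,
    w (gelfand a x - l) @[x --> G] --> (0 : R).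
  have /choice[l Hl] (i : 'I_(\dim {:L})) : exists l : F,
      v (coord b i (gelfand a x) - l) @[x --> G] --> (0 : R).
    apply: (bounded_ultra_cvg F_locally_compact F_nontrivial
      (rho := C * nA a) UG) => x; apply: le_trans (HC _ _) _.
    by rewrite ler_pM2l// gelfand_le.
  by exists (\sum_i l i *: b`_i); exact: (coord_cvg w_ext).
have w_le a (x : X) : w (phi a) <= w (gelfand a x) + w (gelfand a x - phi a).
  rewrite -{1}(subKr (gelfand a x) (phi a)).
  by apply: le_trans (avD _ _ _) _; rewrite avN.
have small (t : L) (h : X -> R) : h x @[x --> G] --> (0 : R) ->
    (forall x, w t <= h x) -> t = 0.
  move=> hG th; apply: (av_eq0 (v := w)); apply/le_anti; rewrite av_ge0 andbT.
  exact: ge_cvg hG th.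
have phiP : is_character phi /\ forall a, w (phi a) <= nA a.
  split; first split.
  - move=> a c; apply/eqP; rewrite -subr_eq0; apply/eqP.
    apply: (small _ (fun x => w (gelfand (a + c) x - phi (a + c)) +
       (w (gelfand a x - phi a) + w (gelfand c x - phi c)))).
      by rewrite -[X in _ --> X]addr0 -[X in _ --> _ + X]addr0; do !apply: cvgD.
    move=> x; rewrite av_distC.
    have -> : phi a + phi c - phi (a + c) = (gelfand (a + c) x - phi (a + c)) -
       ((gelfand a x - phi a) + (gelfand c x - phi c)).
      by rewrite gelfandD; ring.
    apply: le_trans (avD _ _ _) _; rewrite avN lerD2l; exact: avD.
  - move=> a c; apply/eqP; rewrite -subr_eq0; apply/eqP.
    apply: (small _ (fun x => w (gelfand (a * c) x - phi (a * c)) +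
       (nA a * w (gelfand c x - phi c) + w (gelfand a x - phi a) * w (phi c)))).
      rewrite -[X in _ --> X]addr0 -[X in _ --> _ + X]addr0.
      rewrite -[X in _ --> _ + (X + _)](mulr0 (nA a)).
      rewrite -[X in _ --> _ + (_ + X)](mul0r (w (phi c))).
      by apply: cvgD => //; apply: cvgD; [apply: cvgMl_tmp|apply: cvgMr_tmp].
    move=> x; rewrite av_distC.
    have -> : phi a * phi c - phi (a * c) = (gelfand (a * c) x - phi (a * c)) -
       (gelfand a x * (gelfand c x - phi c) + (gelfand a x - phi a) * phi c).
      by rewrite gelfandM; ring.
    apply: le_trans (avD _ _ _) _; rewrite avN lerD2l.
    apply: le_trans (avD _ _ _) _; rewrite !avM lerD2r.
    by rewrite ler_wpM2r ?av_ge0// gelfand_le.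
  - apply/eqP; rewrite eq_sym -subr_eq0; apply/eqP.
    apply: (small _ (fun x => w (gelfand 1 x - phi 1))) => // x.
    by rewrite gelfand1.
  - move=> k a; apply/eqP; rewrite -subr_eq0; apply/eqP.
    apply: (small _ (fun x => w (gelfand (k *: a) x - phi (k *: a)) +
       v k * w (gelfand a x - phi a))).
      rewrite -[X in _ --> X]addr0 -[X in _ --> _ + X](mulr0 (v k)).
      by apply: cvgD => //; apply: cvgMl_tmp.
    move=> x; rewrite av_distC.
    have -> : k *: phi a - phi (k *: a) = (gelfand (k *: a) x - phi (k *: a)) -
       k *: (gelfand a x - phi a).
      rewrite gelfandZ scalerBr opprB.
      by rewrite [RHS]addrC addrA subrK.
    by apply: le_trans (avD _ _ _) _; rewrite avN (ext_avZ w_ext).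
  - move=> a; rewrite -subr_le0.
    apply: (ge_cvg (Hphi a)) => x.
    by rewrite lerBlDl (le_trans (w_le a x))// lerD2r gelfand_le.
exists (exist _ phi phiP); split=> //; apply/char_space_cvgP => a.
by apply/cvg_metricP; exact: Hphi.
Qed.

End Compactness.

(** * Total disconnectedness, Galois action and function algebras *)

Section TotallyDisconnected.
Context {R : realType} {F : fieldType} {v : absval R F}.
Context (F_complete : metric_complete v setT) (v_na : nonarchimedean v).
Context {L : fieldExtType F} {w : absval R L} (w_ext : valued_extension v w).
Context {A : comAlgType F} {nA : banach_norm v A}.
Local Notation X := (char_space w nA).

Lemma gelfand_near a (x : X) e : 0 < e ->
  nbhs x [set y | w (gelfand a y - gelfand a x) < e].
Proof.
move=> e0; have /cvg_metricP/cvg0_ltP H :=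
  @gelfand_continuous _ _ _ _ w _ nA a x.
by apply: H => // y; exact: av_ge0.
Qed.

(** Two distinct characters differ in one F-coordinate k of a value. That k is a
    continuous function to F, where balls are clopen. *)
Lemma char_space_zero_dimensional : zero_dimensional X.
Proof.
move=> x y /eqP/char_space_separated[a axy].
pose b := vbasis {:L}.
pose k i (z : X) := coord b i (gelfand a z).
have [i ixy] : exists i, k i x <> k i y.
  apply: contrapT => h; apply: axy.
  rewrite (vbasis_coord (gelfand a x)) (vbasis_coord (gelfand a y)).
  apply: eq_bigr => i _; congr (_ *: _).
  by apply: contrapT => ?; apply: h; exists i.
have [C C0 HC] := coord_bounded F_complete w_ext.
have knear z e : 0 < e -> nbhs z [set z' | v (k i z' - k i z) < e].
  move=> e0; apply: filterS (gelfand_near a z (divr_gt0 e0 C0)) => z' /= h.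
  rewrite /k -raddfB; apply: le_lt_trans (HC _ _) _.
  by rewrite mulrC -ltr_pdivlMr.
pose e := v (k i x - k i y).
have e0 : 0 < e by apply: av_gt0; rewrite subr_eq0; apply/eqP.
have small p q r : v (p - q) < e -> v (r - q) < e -> v (p - r) < e.
  move=> pq rq; rewrite -(subrKA q p (- r)) -(opprB r q).
  by apply: le_lt_trans (v_na _ _) _; rewrite gt_max pq.
exists [set z | v (k i z - k i x) < e]; split.
- split.
    rewrite openE => z /= ze; apply: filterS (knear z e e0) => z' /= z'z.
    by apply: small z'z _; rewrite av_distC.
  rewrite -openC openE => z /= ze.
  apply: filterS (knear z e e0) => z' /= z'z z'x.
  apply: ze; apply: (small _ (k i z')); first by rewrite av_distC.
  by rewrite av_distC.
- by rewrite /= subrr av0.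
- by rewrite /= av_distC -/e ltxx.
Qed.

End TotallyDisconnected.

Section GaloisAction.
Context {R : realType} {F : fieldType} {v : absval R F}.
Context (F_complete : metric_complete v setT).
Context {L : fieldExtType F} {w : absval R L} (w_ext : valued_extension v w).
Context {A : comAlgType F} {nA : banach_norm v A}.
Context {g : 'End(L)} (gG : Galois_aut g).
Local Notation X := (char_space w nA).

(** Uniqueness of the extension of v. *)
Lemma Galois_isometry x : w (g x) = w x.
Proof.
apply: (absval_ext_unique F_complete w_ext (t := fun x => w (g x))).
- by move=> y; exact: av_ge0.
- by move=> y z; rewrite linearD; exact: avD.
- by move=> y z; rewrite (GaloisM gG) avM.
- by move=> c; rewrite (Galois_alg gG).
Qed.

Lemma Galois_char_subproof (x : X) : is_character (fun a => g (gelfand a x)) /\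
  forall a, w (g (gelfand a x)) <= nA a.
Proof.
split; last by move=> a; rewrite Galois_isometry gelfand_le.
split.
- by move=> a b; rewrite gelfandD linearD.
- by move=> a b; rewrite gelfandM (GaloisM gG).
- by rewrite gelfand1 (Galois1 gG).
- by move=> c a; rewrite gelfandZ linearZ.
Qed.

Definition Galois_act (x : X) : X := exist _ _ (Galois_char_subproof x).

Lemma gelfand_Galois_act a x : gelfand a (Galois_act x) = g (gelfand a x).
Proof. by []. Qed.

Lemma Galois_act_continuous : continuous Galois_act.
Proof.
move=> x; have FF : Filter (Galois_act y @[y --> x]).
  by apply: fmap_filter; exact: nbhs_filter.
apply/char_space_cvgP => a; apply/cvg_metricP/cvg0_ltP.
  by move=> y; exact: av_ge0.
move=> e e0; apply: filterS (gelfand_near a x e0) => y /=.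
by rewrite -linearB Galois_isometry.
Qed.

Lemma gelfand_iter a n x :
  gelfand a (iter n Galois_act x) = iter n g (gelfand a x).
Proof. by elim: n => [//|n IH]; rewrite !iterS gelfand_Galois_act IH. Qed.

Lemma Galois_act_order :
  exists m n, [/\ is_order Galois_act m, is_order g n & (m %| n)%N].
Proof.
have [n gn] := Galois_finite_order gG; case: (gn) => n0 gid _.
have [|m om mn] := @order_dvd _ Galois_act n n0.
  by move=> x; apply: char_space_ext => a; rewrite gelfand_iter gid.
by exists m, n.
Qed.

End GaloisAction.

(** The Gelfand transform composed with an isometric embedding E of L in L'. The
    identity of L gives the function algebra with values in L, and embeddings of
    L in the complex numbers give the complex and the real function algebras. *)
Section Realization.
Context {R : realType} {F : fieldType} {v : absval R F}.
Context {L : fieldExtType F} {w : absval R L}.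
Context {A : comAlgType F} {nA : banach_norm v A}.
Local Notation X := (char_space w nA).
Context (attained : forall a, a != 0 -> exists x : X, w (gelfand a x) = nA a).
Context {L' : fieldType} {w' : absval R L'} (E : L -> L') (iota : F -> L').
Context (ED : forall x y, E (x + y) = E x + E y).
Context (EM : forall x y, E (x * y) = E x * E y).
Context (EF : forall c : F, E c%:A = iota c).
Context (Ew : forall x, w' (E x) = w x).

Definition realization (a : A) (x : X) : L' := E (gelfand a x).
Definition realized : set (X -> L') := range realization.

Let E0 : E 0 = 0. Proof. by apply: (av_eq0 (v := w')); rewrite Ew av0. Qed.
Let EB x y : E (x - y) = E x - E y.
Proof. by rewrite -[in RHS](subrK y x) (ED (x - y)) addrK. Qed.
Let E1 : E 1 = 1.
Proof.
have E10 : E 1 != 0.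
  apply/eqP => h; have := Ew 1; rewrite h av0 av1 => /eqP.
  by rewrite eq_sym oner_eq0.
by apply: (mulIf E10); rewrite -EM !mul1r.
Qed.

Lemma char_space_inhabited : exists x : X, True.
Proof. by have [x _] := attained (oner_neq0 A); exists x. Qed.

Lemma realization_sup_norm a : sup_norm w' (realization a) = nA a.
Proof.
rewrite /sup_norm; set S := [set _ | _ in _].
have Sub y : S y -> y <= nA a.
  by move=> [x _ <-]; rewrite /realization Ew gelfand_le.
have S_a : S (nA a).
  have [a0|a0] := eqVneq a 0.
    have [x _] := char_space_inhabited; exists x => //.
    by rewrite /realization Ew a0 gelfand0 av0 bn0.
  by have [x xa] := attained a0; exists x => //; rewrite /realization Ew.
apply/le_anti/andP; split; first by apply: ge_sup => //; exists (nA a).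
by apply: ub_le_sup => //; exists (nA a).
Qed.

Lemma realization_continuous a : continuous_functions w' (realization a).
Proof.
move=> x; have FX := nbhs_filter (x : X).
apply/cvg_metricP/cvg0_ltP; first by move=> y; exact: av_ge0.
move=> e e0; apply: filterS (gelfand_near a x e0) => y /=.
by rewrite /realization -EB Ew.
Qed.

Lemma realization_isometric :
  isometric_isomorphism w' nA iota realized realization.
Proof.
split.
- split=> [a _|a b _ _ ab|f [a _ <-]]; [by exists a| |by exists a].
  apply/eqP; rewrite -subr_eq0; apply/eqP/(bn_eq0 (nA := nA)).
  rewrite -realization_sup_norm.
  have -> : realization (a - b) = realization 0.
    apply/funext => x; rewrite /realization gelfandB EB.
    have -> : E (gelfand a x) = E (gelfand b x) := congr1 (@^~ x) ab.
    by rewrite subrr gelfand0 E0.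
  by rewrite realization_sup_norm bn0.
- by move=> a b x; rewrite /realization gelfandD ED.
- by move=> a b x; rewrite /realization gelfandM EM.
- by move=> x; rewrite /realization gelfand1 E1.
- by move=> c a x; rewrite /realization gelfandZ -mulr_algl EM EF.
- exact: realization_sup_norm.
Qed.

Lemma realized_function_algebra (C : set (X -> L')) (S : set L') :
  (forall a, C (realization a)) -> S = range iota ->
  function_algebra_in w' C S realized.
Proof.
move=> CA SE.
have isom := realization_isometric.
have sub : function_subalgebra S realized.
  split.
  - exists 0 => //; apply/funext => x.
    by rewrite /realization gelfand0 E0.
  - move=> _ _ [a _ <-] [b _ <-]; exists (a + b) => //; apply/funext => x.
    by rewrite (isomD isom).
  - move=> _ _ [a _ <-] [b _ <-]; exists (a * b) => //; apply/funext => x.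
    by rewrite (isomM isom).
  - move=> c f; rewrite SE => -[k _ <-] [a _ <-]; exists (k *: a) => //.
    by apply/funext => x; rewrite (isomZ isom).
split=> //.
- by move=> _ [a _ <-].
- move=> u uB Cu.
  have /choice[a aE] n : exists a, realization a = u n.
    by have [a _ au] := uB n; exists a.
  have uE b n c : realization c = b -> sup_norm w' (u n - b) = nA (a n - c).
    move=> <-; rewrite -aE -realization_sup_norm; congr (sup_norm w' _).
    by apply/funext => x; rewrite /realization gelfandB EB.
  have [//|e e0|l _ al] := @banach_norm_complete _ _ _ _ nA a.
    have [n0 Hn] := Cu e e0; exists n0 => m n mn nn.
    by have := Hn m n mn nn; rewrite (uE _ m (a n)).
  exists (realization l); first by exists l.
  by under eq_fun do rewrite (uE _ _ l erefl).
- move=> c; rewrite SE => -[k _ <-]; exists k%:A => //; apply/funext => x.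
  by rewrite (isomZ isom) (isom1 isom) mulr1.
- move=> x y /char_space_separated[a axy].
  exists (realization a); first by exists a.
  rewrite /realization => h; apply: axy; apply/eqP; rewrite -subr_eq0.
  by apply/eqP/(av_eq0 (v := w)); rewrite -Ew EB h subrr av0.
Qed.

End Realization.

(** * Finite extensions of the complex and of the real numbers *)

Section Divisors.
Context {F : fieldType} {L : fieldExtType F} (D : {poly F} -> Prop).
Context (hasD : forall q : {poly F}, (1 < size q)%N ->
  exists d, [/\ D d, (1 < size d)%N & d %| q]).

(** The minimal polynomial of x is irreducible, so it is associated with any of
    its divisors of positive degree. *)
Lemma root_of_divisor (x : L) :
  exists2 d, D d & root (map_poly (in_alg L) d) x.
Proof.
have /polyOver1P[q qE] := minPolyOver 1 x.
have sq : (1 < size q)%N.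
  rewrite -(size_map_poly (in_alg L)) -qE size_minPoly ltnS.
  by [].
have [d [Dd sd dq]] := hasD sq.
exists d => //.
have dp : map_poly (in_alg L) d %| minPoly 1 x by rewrite qE dvdp_map.
have /orP[/eqp_root->|] := minPoly_irr (alg_polyOver 1 d) dp.
  exact: root_minPoly.
by rewrite -size_poly_eq1 size_map_poly => /eqP h; rewrite h in sd.
Qed.

End Divisors.

Section ComplexBase.
Context {R : realType} {F : fieldType} {v : absval R F}.
Context {L : fieldExtType F} {w : absval R L} (w_ext : valued_extension v w).
Context {e : {rmorphism F -> R[i]}}.
Context (eP : valued_field_iso v (complex_absval R) e).

Lemma complex_ext_trivial (x : L) : exists c : F, x = c%:A.
Proof.
have [[e' eK e'K] _] := eP.
have [|d [c ->]] := @root_of_divisor _ L (fun d => exists c, d = 'X - c%:P) _ x.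
  move=> q sq; have : size (map_poly e q) != 1 by rewrite size_map_poly gtn_eqF.
  move=> /closed_rootP[z]; rewrite -(e'K z) fmorph_root => rz.
  exists ('X - (e' z)%:P); rewrite size_XsubC dvdp_XsubCl; split=> //.
  by exists (e' z).
rewrite rmorphB/= map_polyX map_polyC root_XsubC => /eqP->.
by exists c.
Qed.

Lemma complex_embedding : exists E : L -> R[i],
  [/\ forall x y, E (x + y) = E x + E y, forall x y, E (x * y) = E x * E y,
      forall c : F, E c%:A = e c & forall x, complex_absval R (E x) = w x].
Proof.
have /choice[k kE] := complex_ext_trivial.
have kA (c : F) : k c%:A = c.
  by apply: (fmorph_inj (in_alg L)); rewrite /= -kE.
exists (fun x => e (k x)); split.
- move=> x y; rewrite -rmorphD; congr (e _).
  by rewrite {1}(kE x) {1}(kE y) -scalerDl kA.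
- move=> x y; rewrite -rmorphM; congr (e _).
  by rewrite {1}(kE x) {1}(kE y) mulr_algl scalerA kA.
- by move=> c; rewrite kA.
- by move=> x; rewrite eP.2 {2}(kE x) w_ext.
Qed.

End ComplexBase.

Lemma quadratic_factorization (K : comNzRingType) (a c z z' : K) :
  z + z' = a + a -> z * z' = a ^+ 2 + c ->
  ('X - z%:P) * ('X - z'%:P) = ('X - a%:P) ^+ 2 + c%:P.
Proof.
move=> zD zM.
have hD : z%:P + z'%:P = a%:P + a%:P by rewrite -!polyCD zD.
have hM : z%:P * z'%:P = a%:P ^+ 2 + c%:P by rewrite -polyCM zM polyCD rmorphXn.
have -> : ('X - z%:P) * ('X - z'%:P) =
          'X * 'X - (z%:P + z'%:P) * 'X + z%:P * z'%:P by ring.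
by rewrite hD hM; ring.
Qed.

Section RealBase.
Context {R : realType} {F : fieldType} {v : absval R F}.
Context (F_complete : metric_complete v setT).
Context {L : fieldExtType F} {w : absval R L} (w_ext : valued_extension v w).
Context {e : {rmorphism F -> R}} (eP : valued_field_iso v (real_absval R) e).
Context {g : 'End(L)} (gG : Galois_aut g) (gF : fixedSpace g = 1%VS).
Local Open Scope complex_scope.

(** A complex root z of a polynomial over F yields the factor X - z if z is real
    and (X - z) * (X - conj z) otherwise. *)
Lemma real_quadratic (x : L) : (exists c : F, x = c%:A) \/
  exists a b : F, b != 0 /\ (x - a%:A) ^+ 2 = - (b%:A) ^+ 2.
Proof.
have [[e' eK e'K] _] := eP.
pose D (d : {poly F}) := (exists c, d = 'X - c%:P) \/
  exists a b, b != 0 /\ d = ('X - a%:P) ^+ 2 + (b ^+ 2)%:P.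
pose ec : {rmorphism F -> R[i]} := real_complex R \o e.
have ecE c : ec c = (e c)%:C by [].
have [|d []] := @root_of_divisor _ L D _ x.
- move=> q sq.
  have : size (map_poly ec q) != 1 by rewrite size_map_poly gtn_eqF.
  move=> /closed_rootP[[alpha beta] rz].
  set a := e' alpha; set b := e' beta.
  have aE : alpha = e a by rewrite /a e'K.
  have bE : beta = e b by rewrite /b e'K.
  have [b0|b0] := eqVneq b 0.
    exists ('X - a%:P); rewrite size_XsubC dvdp_XsubCl; split=> //.
      by left; exists a.
    by move: rz; rewrite aE bE b0 rmorph0 complexr0 -ecE fmorph_root.
  exists (('X - a%:P) ^+ 2 + (b ^+ 2)%:P); split.
  - by right; exists a, b.
  - rewrite size_polyDl size_exp_XsubC// size_polyC.
    by case: (_ == _).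
  rewrite -(dvdp_map ec) rmorphD rmorphXn rmorphB/= map_polyX !map_polyC.
  rewrite -(@quadratic_factorization _ _ _
    (Complex alpha beta) (Complex alpha (- beta))).
  - rewrite Gauss_dvdp; last first.
      apply: coprimep_XsubC2; rewrite subr_eq0 eq_complex /= eqxx /=.
      by rewrite eqNr bE fmorph_eq0.
    rewrite !dvdp_XsubCl rz.
    rewrite -[Complex alpha (- beta)]/(conjc (Complex alpha beta)).
    rewrite -complex_root_conj -map_poly_comp.
    rewrite (_ : map_poly _ q = map_poly ec q)//.
    by apply: eq_map_poly => c; rewrite /= oppr0.
  - by rewrite /= aE; apply/eqP; rewrite eq_complex /=; simpc.
  - rewrite /= aE; apply/eqP; rewrite eq_complex /=; simpc.
    by rewrite rmorphXn -bE; apply/andP; split; apply/eqP; ring.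
- move=> [c ->]; rewrite rmorphB/= map_polyX map_polyC root_XsubC => /eqP->.
  by left; exists c.
move=> [a [b [b0 ->]]].
rewrite rmorphD rmorphXn rmorphB/= map_polyX !map_polyC/= /root !hornerE.
rewrite addr_eq0 => /eqP h; right; exists a, b; split=> //.
by rewrite h -in_algE rmorphXn.
Qed.

(** If L is not F, completing the square gives j with j ^ 2 = -1. Any other x
    has (x - c) / d also equal to j or - j, and g j = j would make g trivial. *)
Lemma real_decomposition : (forall x : L, exists c : F, x = c%:A) \/
  exists j : L, [/\ j ^+ 2 = -1, g j = - j &
                 forall x : L, exists ab : F * F, x = ab.1%:A + ab.2 *: j].
Proof.
have [triv|] := pselect (forall x : L, exists c : F, x = c%:A); first by left.
move=> /existsNP[x0 x0F]; right.
have [|[a [b [b0 x0E]]]] := real_quadratic x0; first by [].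
have bA0 (c : F) : c != 0 -> c%:A != 0 :> L.
  by move=> c0; rewrite -in_algE fmorph_eq0.
pose j := (x0 - a%:A) / b%:A.
have j2 : j ^+ 2 = -1.
  by rewrite expr_div_n x0E mulNr mulfV// expf_neq0// bA0.
have spanj (x : L) : exists ab : F * F, x = ab.1%:A + ab.2 *: j.
  have [[c ->]|[c [d [d0 xE]]]] := real_quadratic x.
    by exists (c, 0); rewrite scale0r addr0.
  have : ((x - c%:A) / d%:A) ^+ 2 == j ^+ 2.
    by rewrite j2 expr_div_n xE mulNr mulfV// expf_neq0// bA0.
  rewrite eqf_sqr => /orP[] /eqP h.
    exists (c, d); rewrite /= -(mulr_algl d) -h mulrCA mulfV ?bA0// mulr1.
    by rewrite addrC subrK.
  exists (c, - d); rewrite /= scaleNr -scalerN -(mulr_algl d) -h.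
  rewrite mulrCA mulfV ?bA0// mulr1.
  by rewrite addrC subrK.
exists j; split=> //.
have : (g j) ^+ 2 == j ^+ 2.
  by rewrite expr2 -(GaloisM gG) -expr2 j2 linearN /= (Galois1 gG).
rewrite eqf_sqr => /orP[] /eqP // gj; exfalso; apply: x0F.
have : x0 \in fixedSpace g.
  apply/fixedSpaceP; have [[p q] ->] := spanj x0.
  by rewrite /= linearD linearZ /= (Galois1 gG) linearZ /= gj.
by rewrite gF => /vlineP.
Qed.

(** If L = F + F * j, the embedding sends a + b * j to the complex number with
    parts e a and e b. *)
Lemma real_embedding : exists E : L -> R[i],
  [/\ forall x y, E (x + y) = E x + E y, forall x y, E (x * y) = E x * E y,
      forall c : F, E c%:A = real_complex R (e c),
      forall x, complex_absval R (E x) = w x &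
      forall x, E (g x) = conjc (E x)].
Proof.
suff [E [ED EM EF Eg]] : exists E : L -> R[i],
  [/\ forall x y, E (x + y) = E x + E y, forall x y, E (x * y) = E x * E y,
      forall c : F, E c%:A = real_complex R (e c) &
      forall x, E (g x) = conjc (E x)].
  exists E; split=> //.
  apply: (absval_ext_unique F_complete w_ext
    (t := fun x => complex_absval R (E x))).
  - by move=> x; exact: av_ge0.
  - by move=> x y; rewrite ED avD.
  - by move=> x y; rewrite EM avM.
  - move=> c; rewrite EF -eP.2 /group_norm_fun /=.
    by rewrite expr0n /= addr0 sqrtr_sqr.
have [triv|[j [j2 gj spanj]]] := real_decomposition.
  have /choice[k kE] := triv.
  have kA (c : F) : k c%:A = c.
    by apply: (fmorph_inj (in_alg L)); rewrite /= -kE.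
  exists (fun x => real_complex R (e (k x))); split.
  - move=> x y; rewrite -!rmorphD; do 2 congr (_ _).
    by rewrite {1}(kE x) {1}(kE y) -scalerDl kA.
  - move=> x y; rewrite -!rmorphM; do 2 congr (_ _).
    by rewrite {1}(kE x) {1}(kE y) mulr_algl scalerA kA.
  - by move=> c; rewrite kA.
  - by move=> x; rewrite conjc_real {1}(kE x) (Galois_alg gG) kA.
have jF (c : F) : j <> c%:A.
  move=> jc; have : e c ^+ 2 = -1.
    rewrite -rmorphXn -(rmorphN1 e); congr (e _).
    apply: (fmorph_inj (in_alg L)).
    by rewrite rmorphXn rmorphN1 /= -jc j2.
  by move=> h; have := sqr_ge0 (e c); rewrite h oppr_ge0 ler10.
have uniq_ab (a b c d : F) : a%:A + b *: j = c%:A + d *: j -> a = c /\ b = d.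
  move=> h; have h1 : (b - d) *: j = (c - a)%:A.
    by apply/eqP; rewrite !scalerBl subr_eq addrAC -h [X in _ == X]addrC addKr.
  have bd : b = d.
    apply/eqP; rewrite -subr_eq0; apply/negP => /negP bd0.
    apply: (jF ((b - d)^-1 * (c - a))).
    by rewrite -scalerA -h1 scalerA mulVf// scale1r.
  split=> //; move: h; rewrite bd => /addIr h.
  exact: (fmorph_inj (in_alg L)).
have /choice[k kE] := spanj.
have kA (a b : F) : k (a%:A + b *: j) = (a, b).
  have [] := uniq_ab _ _ _ _ (kE (a%:A + b *: j)).
  by case: (k _) => p q /= -> ->.
exists (fun x => Complex (e (k x).1) (e (k x).2)); split.
- move=> x y; apply/eqP; rewrite eq_complex /= -!rmorphD.
  rewrite (_ : k (x + y) = ((k x).1 + (k y).1, (k x).2 + (k y).2)) ?eqxx//.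
  by rewrite -kA {1}(kE x) {1}(kE y) addrACA -!scalerDl.
- move=> x y; apply/eqP; rewrite eq_complex /= -!rmorphM -rmorphB -rmorphD.
  rewrite (_ : k (x * y) = ((k x).1 * (k y).1 - (k x).2 * (k y).2,
                            (k x).1 * (k y).2 + (k x).2 * (k y).1)) ?eqxx//.
  rewrite -kA {1}(kE x) {1}(kE y).
  rewrite -!(mulr_algl _ j) scalerBl scalerDl -!scalerA.
  rewrite -!(mulr_algl (_ : F) (_ *: 1)).
  have -> (p q r s : L) : (p + q * j) * (r + s * j) =
      p * r + q * s * j ^+ 2 + (p * s + q * r) * j by ring.
  by rewrite j2 mulrN1.
- move=> c; have -> : k c%:A = (c, 0) by rewrite -(kA c 0) scale0r addr0.
  by rewrite /= rmorph0.
- move=> x; rewrite /= {1 2}(kE x).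
  rewrite linearD linearZ /= (Galois1 gG) linearZ /= gj scalerN -scaleNr kA /=.
  by rewrite rmorphN.
Qed.

End RealBase.

(** * The representation theorem *)

Unset Implicit Arguments.

Theorem theorem1p1p1 (R : realType) (F : fieldType) (v : absval R F)
    (A : comAlgType F) (nA : banach_norm v A)
    (F_complete : metric_complete v setT)
    (F_locally_compact : locally_compact [set: metric_of v])
    (F_nontrivial : nontrivial_absval v)
    (A_square : forall a : A, nA (a ^+ 2) = nA a ^+ 2)
    (A_fbd : finite_basic_dimension nA) :
  exists X : topologicalType,
    [/\ compact [set: X] /\ hausdorff_space X,
        (forall e : {rmorphism F -> R[i]},
           valued_field_iso v (complex_absval R) e ->
           exists2 B : set (X -> R[i]),
             complex_uniform_algebra B &
             isometrically_isomorphic (complex_absval R) nA e B),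
        (forall e : {rmorphism F -> R},
           valued_field_iso v (real_absval R) e ->
           exists2 tau : X -> X, topological_involution tau &
           exists2 B : set (X -> R[i]),
             real_function_algebra tau B &
             isometrically_isomorphic (complex_absval R) nA
               (fun c => real_complex R (e c)) B),
        (nonarchimedean v ->
           totally_disconnected [set: X] /\
           exists (L : fieldExtType F) (w : absval R L) (tau : X -> X)
                  (g : 'End(L)),
             [/\ basic_setting v w tau g, fixedSpace g = 1%VS &
             exists2 B : set (X -> L),
               ext_function_algebra w tau g B &
               isometrically_isomorphic w nA (fun c : F => c%:A) B]) &
        exists (L : fieldExtType F) (w : absval R L) (tau : X -> X)
               (g : 'End(L)),
          basic_setting v w tau g /\
          exists B : set (X -> L),
            [/\ B `<=` basic_function_algebra w tau g,
                function_subalgebra (fixed_field g) B,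
                separates_points B &
                isometrically_isomorphic w nA (fun c : F => c%:A) B]].
Proof.
have [L [w [w_ext embedding [g gG gF]]]] := A_fbd.
have attained (a : A) :
    a != 0 -> exists x : char_space w nA, w (gelfand a x) = nA a.
  move=> a0; have [phi [phiC phi_le phi_a]] :=
    norm_attained_char F_complete w_ext A_square embedding a0.
  by exists (exist _ phi (conj phiC phi_le)).
pose tau := @Galois_act _ _ _ F_complete _ _ w_ext _ nA _ gG.
have compactX : compact [set: char_space w nA].
  exact: (char_space_compact F_complete F_locally_compact F_nontrivial w_ext).
have tdX : nonarchimedean v -> totally_disconnected [set: char_space w nA].
  move=> v_na; apply: zero_dimension_totally_disconnected.
  exact: (char_space_zero_dimensional F_complete v_na w_ext).
have setting : basic_setting v w tau g.
  split=> //.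
  - exact: (ext_complete F_complete w_ext).
  - exact: char_space_hausdorff.
  - exact: Galois_act_continuous.
  - exact: Galois_act_order.
have scalars : fixed_field g = range (fun c : F => c%:A : L).
  rewrite /fixed_field gF; apply/seteqP; split=> c /=.
    by move=> /vlineP[k ->]; exists k.
  by move=> [k _ <-]; apply/vlineP; exists k.
pose B := realized (w := w) (nA := nA) (fun y : L => y).
have BC (a : A) : basic_function_algebra w tau g
    (realization (w := w) (nA := nA) (fun y : L => y) a).
  by split=> //; exact: (realization_continuous (w' := w)).
have Bfalg : ext_function_algebra w tau g B.
  exact: (realized_function_algebra attained (w' := w)
    (iota := fun c : F => c%:A)).
have Bisom : isometrically_isomorphic w nA (fun c : F => c%:A) B.
  by exists (realization (fun y : L => y)); exact: realization_isometric.
exists (char_space w nA); split.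
- by split=> //; exact: char_space_hausdorff.
- move=> e eP; have [E [ED EM EF Ew]] := complex_embedding w_ext eP.
  exists (realized (w := w) (nA := nA) E).
    apply: (realized_function_algebra attained ED EM EF Ew).
      by move=> a; exact: (realization_continuous ED Ew).
    by apply/seteqP; split=> // c _; have [[e' _ e'K] _] := eP; exists (e' c).
  exists (realization E).
  exact: (realization_isometric attained ED EM EF Ew).
- move=> e eP.
  have [E [ED EM EF Ew Eg]] := real_embedding F_complete w_ext eP gG gF.
  exists tau.
    split; first exact: Galois_act_continuous.
    move=> x; apply: char_space_ext => a; rewrite !gelfand_Galois_act.
    (* E is injective and carries g to complex conjugation *)
    set y := gelfand a x; apply/eqP; rewrite -subr_eq0.
    apply/eqP/(av_eq0 (v := w)).
    have h : E (g (g y) - y) + E y = 0 + E y.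
      by rewrite -ED subrK !Eg conjcK add0r.
    by rewrite -Ew (addIr _ h) av0.
  exists (realized (w := w) (nA := nA) E).
    apply: (realized_function_algebra attained ED EM EF Ew).
      move=> a; split; first exact: (realization_continuous ED Ew).
      by move=> x; rewrite /realization gelfand_Galois_act Eg.
    apply/seteqP; split=> [_ [c _ <-]|_ [c _ <-]]; last by exists (e c).
    by have [[e' _ e'K] _] := eP; exists (e' c) => //; rewrite e'K.
  exists (realization E).
  exact: (realization_isometric attained ED EM EF Ew).
- move=> v_na; split; first exact: tdX.
  by exists L, w, tau, g; split=> //; exists B.
- exists L, w, tau, g; split=> //; exists B; split=> //.
  + exact: (falg_sub Bfalg).
  + exact: (falg_subalg Bfalg).
  + exact: (falg_separates Bfalg).
Qed.
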